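(* Let $n\ge 1$ and let $\theta=(\theta_{jk})_{j,k=1,\dots,n}$ be a matrix with entries in the unit circle $\mathbb{T}$ such that $\theta_{kj}=\overline{\theta_{jk}}$ and $\theta_{jj}=1$ for all $j,k$. Then the Banach $*$-algebra $\ell^1(\mathbb{Z}^n,\theta)$ is inverse-closed in the non-commutative torus $C^*(\theta)$.
   Context: Define $\sigma:\mathbb{Z}^n\times\mathbb{Z}^n\to\mathbb{T}$ by $\sigma(l,m)=\prod_{1\le j<k\le n}\theta_{k,j}^{\,l_k m_j}$. For $f,g\in\ell^1(\mathbb{Z}^n)$ the twisted convolution is $(f\,\natural_\theta\, g)(x)=\sum_{y\in\mathbb{Z}^n} f(y)g(x-y)\sigma(y,x-y)$, and the involution is $f^*(x)=\overline{\sigma(x,-x)}\,\overline{f(-x)}$, $x\in\mathbb{Z}^n$. With these operations and the $\ell^1$-norm, $\ell^1(\mathbb{Z}^n)$ is a unital Banach $*$-algebra, denoted $\ell^1(\mathbb{Z}^n,\theta)$; its unit is $\delta_0$. The non-commutative torus $C^*(\theta)$ is the universal $C^*$-algebra generated by unitaries $U_1,\dots,U_n$ with $U_jU_k=\theta_{jk}U_kU_j$. It is the enveloping $C^*$-algebra of $\ell^1(\mathbb{Z}^n,\theta)$, and it is identified with the operator-norm closure of $\lambda(\ell^1(\mathbb{Z}^n))$ in the bounded operators on $\ell^2(\mathbb{Z}^n)$, where $\lambda(f)g=f\,\natural_\theta\, g$ for $f\in\ell^1(\mathbb{Z}^n)$, $g\in\ell^2(\mathbb{Z}^n)$ is the (faithful)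 regular representation. The algebra $\ell^1(\mathbb{Z}^n,\theta)$ is regarded as a subalgebra of $C^*(\theta)$ via $f\mapsto\lambda(f)$. Let $\mathcal{A}\subseteq\mathcal{B}$ be algebras with common identity. $\mathcal{A}$ is called inverse-closed in $\mathcal{B}$ if $a\in\mathcal{A}$ and $a^{-1}\in\mathcal{B}$ imply $a^{-1}\in\mathcal{A}$. *)

(* Defs.v *)
(* MathComp-Analysis, with complex numbers R[i] over an arbitrary R : realType. *)
From HB Require Import structures.
From mathcomp Require Import all_boot all_order all_algebra.
From mathcomp Require Import complex.
From mathcomp Require Import all_classical all_reals all_analysis.
From mathcomp Require Import ring lra.

Set Implicit Arguments.
Unset Strict Implicit.
Unset Printing Implicit Defensive.

Import Order.TTheory GRing.Theory Num.Theory.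
Import numFieldNormedType.Exports.

Local Open Scope classical_set_scope.
Local Open Scope ring_scope.
Local Open Scope complex_scope.

(* |z| as an element of R; the library norm on R[i] takes its values in R[i]. *)
Definition cabs (R : rcfType) (z : R[i]) : R := complex.Re `|z|.

Section cabs.
Variable R : rcfType.
Implicit Types z w : R[i].

Lemma cabsE z : `|z| = (cabs z)%:C.
Proof. by rewrite /cabs RRe_real// normr_real. Qed.

Lemma cabs_ge0 z : 0 <= cabs z.
Proof. by rewrite -lecR -cabsE normr_ge0. Qed.

Lemma cabsD z w : cabs (z + w) <= cabs z + cabs w.
Proof. by rewrite -lecR rmorphD/= -!cabsE ler_normD. Qed.

Lemma cabsM z w : cabs (z * w) = cabs z * cabs w.
Proof. by apply/(@complexI R); rewrite rmorphM/= -!cabsE normrM. Qed.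

Lemma cabs0 : cabs (0 : R[i]) = 0.
Proof. by apply/(@complexI R); rewrite -cabsE normr0. Qed.

Lemma cabs_eq0 z : cabs z = 0 -> z = 0.
Proof. by move=> h; apply/eqP; rewrite -normr_eq0 cabsE h. Qed.

Lemma Re_le_cabs z : `|complex.Re z| <= cabs z.
Proof. by rewrite -lecR -cabsE normc_ge_Re. Qed.

Lemma Im_le_cabs z : `|complex.Im z| <= cabs z.
Proof.
rewrite /cabs normc_def/= -sqrtr_sqr ler_sqrt ?addr_ge0 ?sqr_ge0//.
by rewrite lerDr sqr_ge0.
Qed.

Lemma cabs_le_ReIm (a b : R) : cabs (a +i* b) <= `|a| + `|b|.
Proof.
rewrite /cabs normc_def/= -[leRHS]ger0_norm ?addr_ge0//.
rewrite -[leRHS]sqrtr_sqr ler_wsqrtr// sqrrD !real_normK ?num_real//.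
by rewrite lerD2r lerDl mulrn_wge0// mulr_ge0.
Qed.
End cabs.

Section nnsum.
Variables (R : realType) (T : choiceType).
Implicit Types f g : T -> R.

(* Unconditional sum of a nonnegative family. *)
Definition nnsum f : \bar R := \esum_(x in [set: T]) (f x)%:E.

Lemma nnsum_ge0 f : (forall x, 0 <= f x) -> (0 <= nnsum f)%E.
Proof. by move=> f0; apply: esum_ge0 => x _; rewrite lee_fin. Qed.

Lemma le_nnsum f g : (forall x, f x <= g x) -> (nnsum f <= nnsum g)%E.
Proof. by move=> fg; apply: le_esum => x _; rewrite lee_fin. Qed.

Lemma eq_nnsum f g : f =1 g -> nnsum f = nnsum g.
Proof. by move=> fg; apply: eq_esum => x _; rewrite fg. Qed.

Lemma nnsumD f g : (forall x, 0 <= f x) -> (forall x, 0 <= g x) ->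
  nnsum (fun x => f x + g x) = (nnsum f + nnsum g)%E.
Proof.
by move=> f0 g0; rewrite /nnsum -esumD// => x _; rewrite lee_fin.
Qed.

Lemma nnsumZ (c : R) f : 0 <= c -> (forall x, 0 <= f x) ->
  nnsum (fun x => c * f x) = (c%:E * nnsum f)%E.
Proof.
move=> c0 f0; rewrite /nnsum /esum -ereal_supZl//; last first.
  apply/set0P; exists (\sum_(x \in set0) (f x)%:E)%E.
  by exists set0 => //; exact: fsets_set0.
congr ereal_sup; apply/seteqP; split=> [_ [A sA <-]|_ [_ [A sA <-] <-]] /=.
  exists (\sum_(x \in A) (f x)%:E)%E; first by exists A.
  rewrite ge0_mule_fsumr; last by move=> x; rewrite lee_fin.
  by apply: eq_fsbigr => x _; rewrite EFinM.
exists A => //; rewrite ge0_mule_fsumr; last by move=> x; rewrite lee_fin.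
by apply: eq_fsbigr => x _; rewrite EFinM.
Qed.

Lemma nnsum_ge1 f x : (forall x, 0 <= f x) -> ((f x)%:E <= nnsum f)%E.
Proof.
move=> f0; apply: esum_ge; exists [set x]; first by split.
by rewrite fsbig_set1.
Qed.

Lemma nnsum0 : nnsum (fun=> 0) = 0%E.
Proof. by rewrite /nnsum esum1. Qed.

Lemma fin_nnsum f : (forall x, 0 <= f x) -> (nnsum f < +oo)%E ->
  nnsum f \is a fin_num.
Proof. by move=> f0 foo; rewrite ge0_fin_numE// nnsum_ge0. Qed.

Lemma nnsumZ_fin (c : R) f : 0 <= c -> (forall x, 0 <= f x) ->
  (nnsum f < +oo)%E -> (nnsum (fun x => (c * f x)%R) < +oo)%E.
Proof. by move=> c0 f0 foo; rewrite nnsumZ// lte_mul_pinfty// lee_fin. Qed.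
End nnsum.

Lemma nnsum_exchange (R : realType) (T T' : choiceType) (f : T -> T' -> R) :
  (forall x y, 0 <= f x y) ->
  (\esum_(x in [set: T]) nnsum (f x) =
   \esum_(y in [set: T']) nnsum (fun x => f x y))%E.
Proof.
move=> f0; rewrite /nnsum.
rewrite (@esum_esum _ _ _ _ (fun=> setT) (fun x y => (f x y)%:E)); last first.
  by move=> *; rewrite lee_fin.
rewrite (@esum_esum _ _ _ _ (fun=> setT) (fun y x => (f x y)%:E)); last first.
  by move=> *; rewrite lee_fin.
rewrite (reindex_esum (setT `*`` (fun=> setT)) (setT `*`` (fun=> setT))
  (fun p : T' * T => (p.2, p.1)))//.
split => //; first by move=> [x y] [x' y'] _ _ [-> ->].
by move=> [x y] _; exists (y, x).
Qed.

Section rsum.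
Variables (R : realType) (T : choiceType).
Implicit Types u v : T -> R.

(* Sum of an absolutely summable family, i.e. its integral for the counting
   measure: positive part minus negative part.  The value is meaningless when
   the family is not absolutely summable. *)
Definition rsum u : R :=
  fine (nnsum (fun x => Num.max (u x) 0)) -
  fine (nnsum (fun x => Num.max (- u x) 0)).

Lemma max0_ge0 (a : R) : 0 <= Num.max a 0.
Proof. by rewrite le_max lexx orbT. Qed.
Hint Resolve max0_ge0 : core.

Lemma max0_le (a : R) : Num.max a 0 <= `|a|.
Proof. by rewrite ge_max ler_norm normr_ge0. Qed.

Lemma max0B (a : R) : Num.max a 0 - Num.max (- a) 0 = a.
Proof.
have [a0|a0] := leP 0 a.
  by rewrite max_r ?oppr_le0// subr0.
by rewrite max_l ?oppr_ge0 1?ltW// sub0r opprK.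
Qed.

Lemma max0D (a : R) : Num.max a 0 + Num.max (- a) 0 = `|a|.
Proof.
have [a0|a0] := leP 0 a.
  by rewrite max_r ?oppr_le0// addr0 ger0_norm.
by rewrite max_l ?oppr_ge0 1?ltW// add0r ltr0_norm.
Qed.

Lemma nnsum_pos_fin u : (nnsum (fun x => `|u x|%R) < +oo)%E ->
  (nnsum (fun x => Num.max (u x) 0%R) < +oo)%E.
Proof. by apply: le_lt_trans; apply: le_nnsum => x; exact: max0_le. Qed.

Lemma nnsum_neg_fin u : (nnsum (fun x => `|u x|%R) < +oo)%E ->
  (nnsum (fun x => Num.max (- u x)%R 0%R) < +oo)%E.
Proof.
by apply: le_lt_trans; apply: le_nnsum => x; rewrite -normrN; exact: max0_le.
Qed.

Lemma rsumE u (p q : T -> R) :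
  (forall x, 0 <= p x) -> (forall x, 0 <= q x) ->
  (nnsum p < +oo)%E -> (nnsum q < +oo)%E -> (forall x, u x = p x - q x) ->
  rsum u = fine (nnsum p) - fine (nnsum q).
Proof.
move=> p0 q0 poo qoo upq.
have uoo : (nnsum (fun x => `|u x|%R) < +oo)%E.
  apply: (@le_lt_trans _ _ (nnsum p + nnsum q)%E); last by rewrite lte_add_pinfty.
  rewrite -nnsumD//; apply: le_nnsum => x; rewrite upq.
  by rewrite (le_trans (ler_normB _ _))// !ger0_norm.
have : (nnsum (fun x => Num.max (u x) 0%R) + nnsum q =
        nnsum p + nnsum (fun x => Num.max (- u x)%R 0%R))%E.
  rewrite -!nnsumD//; apply: eq_nnsum => x.
  by have := max0B (u x); rewrite {3}upq; lra.
move=> /(congr1 fine); rewrite !fineD; try by apply: fin_nnsum => //;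
  [exact: nnsum_pos_fin|exact: nnsum_neg_fin].
all: try exact: fin_nnsum.
- by rewrite /rsum => h; lra.
- by apply: fin_nnsum => //; exact: nnsum_neg_fin.
- by apply: fin_nnsum => //; exact: nnsum_pos_fin.
Qed.

Lemma rsumD u v : (nnsum (fun x => `|u x|%R) < +oo)%E ->
  (nnsum (fun x => `|v x|%R) < +oo)%E ->
  rsum (fun x => u x + v x) = rsum u + rsum v.
Proof.
move=> uoo voo.
have [up un] := (nnsum_pos_fin uoo, nnsum_neg_fin uoo).
have [vp vn] := (nnsum_pos_fin voo, nnsum_neg_fin voo).
rewrite (@rsumE _ (fun x => Num.max (u x) 0 + Num.max (v x) 0)
  (fun x => Num.max (- u x) 0 + Num.max (- v x) 0)).
- rewrite !nnsumD// !fineD; try exact: fin_nnsum.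
  by rewrite /rsum; lra.
- by move=> x; rewrite addr_ge0.
- by move=> x; rewrite addr_ge0.
- by rewrite nnsumD// lte_add_pinfty.
- by rewrite nnsumD// lte_add_pinfty.
- by move=> x; have := max0B (u x); have := max0B (v x); lra.
Qed.

Lemma rsumZ (c : R) u : (nnsum (fun x => `|u x|%R) < +oo)%E ->
  rsum (fun x => c * u x) = c * rsum u.
Proof.
move=> uoo; have [up un] := (nnsum_pos_fin uoo, nnsum_neg_fin uoo).
have [c0|c0] := leP 0 c.
  rewrite (@rsumE _ (fun x => c * Num.max (u x) 0)
    (fun x => c * Num.max (- u x) 0)).
  - by rewrite !nnsumZ// !fineM//; [rewrite /rsum mulrBr| exact: fin_nnsum..].
  - by move=> x; rewrite mulr_ge0.
  - by move=> x; rewrite mulr_ge0.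
  - exact: nnsumZ_fin.
  - exact: nnsumZ_fin.
  - by move=> x; rewrite -mulrBr max0B.
have c0' : 0 <= - c by lra.
rewrite (@rsumE _ (fun x => - c * Num.max (- u x) 0)
  (fun x => - c * Num.max (u x) 0)).
- rewrite !nnsumZ// !fineM//; try exact: fin_nnsum.
  by rewrite /rsum/=; lra.
- by move=> x; rewrite mulr_ge0.
- by move=> x; rewrite mulr_ge0.
- exact: nnsumZ_fin.
- exact: nnsumZ_fin.
- by move=> x; rewrite -mulrBr -opprB max0B mulrNN.
Qed.

Lemma rsum_le u (M : R) : (nnsum (fun x => `|u x|%R) <= M%:E)%E ->
  `|rsum u| <= M.
Proof.
move=> uM; have uoo := le_lt_trans uM (ltry M).
have [up un] := (nnsum_pos_fin uoo, nnsum_neg_fin uoo).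
have : fine (nnsum (fun x => Num.max (u x) 0)) +
   fine (nnsum (fun x => Num.max (- u x) 0)) <= M.
  rewrite -lee_fin EFinD !fineK; try exact: fin_nnsum.
  rewrite -nnsumD//; apply: le_trans uM; apply: le_nnsum => x.
  by rewrite max0D.
have := fine_ge0 (nnsum_ge0 (fun x => max0_ge0 (u x))).
have := fine_ge0 (nnsum_ge0 (fun x => max0_ge0 (- u x))).
rewrite /rsum ler_norml; lra.
Qed.
End rsum.

Section csum.
Variables (R : realType) (T : choiceType).
Implicit Types F G : T -> R[i].

(* Componentwise; same proviso of absolute summability as rsum. *)
Definition csum F : R[i] :=
  rsum (fun x => complex.Re (F x)) +i* rsum (fun x => complex.Im (F x)).

Lemma csummable_Re F : (nnsum (fun x => cabs (F x)) < +oo)%E ->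
  (nnsum (fun x => `|complex.Re (F x)|%R) < +oo)%E.
Proof. by apply: le_lt_trans; apply: le_nnsum => x; exact: Re_le_cabs. Qed.

Lemma csummable_Im F : (nnsum (fun x => cabs (F x)) < +oo)%E ->
  (nnsum (fun x => `|complex.Im (F x)|%R) < +oo)%E.
Proof. by apply: le_lt_trans; apply: le_nnsum => x; exact: Im_le_cabs. Qed.

Lemma eq_csum F G : F =1 G -> csum F = csum G.
Proof. by move=> FG; congr csum; exact/funext. Qed.

Lemma csumD F G : (nnsum (fun x => cabs (F x)) < +oo)%E ->
  (nnsum (fun x => cabs (G x)) < +oo)%E ->
  csum (fun x => F x + G x) = csum F + csum G.
Proof.
move=> Foo Goo.
have ReE := rsumD (csummable_Re Foo) (csummable_Re Goo).
have ImE := rsumD (csummable_Im Foo) (csummable_Im Goo).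
rewrite /csum.
have -> : (fun x => complex.Re (F x + G x)) =
    (fun x => complex.Re (F x) + complex.Re (G x)).
  by apply/funext => x; case: (F x) => ? ?; case: (G x).
have -> : (fun x => complex.Im (F x + G x)) =
    (fun x => complex.Im (F x) + complex.Im (G x)).
  by apply/funext => x; case: (F x) => ? ?; case: (G x).
by rewrite ReE ImE.
Qed.

Lemma csumZ (c : R[i]) F : (nnsum (fun x => cabs (F x)) < +oo)%E ->
  csum (fun x => c * F x) = c * csum F.
Proof.
move=> Foo; have [Roo Ioo] := (csummable_Re Foo, csummable_Im Foo).
have Zoo (d : R) u : (nnsum (fun x => `|u x|%R) < +oo)%E ->
    (nnsum (fun x : T => `|d * u x|%R) < +oo)%E.
  move=> uoo; rewrite (eq_nnsum (g := fun x => `|d| * `|u x|)); last first.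
    by move=> x; rewrite normrM.
  exact: nnsumZ_fin.
case: c => a b; rewrite /csum.
have -> : (fun x => complex.Re ((a +i* b) * F x)) =
    (fun x => a * complex.Re (F x) + (- b) * complex.Im (F x)).
  by apply/funext => x; case: (F x) => ? ? /=; rewrite mulNr.
have -> : (fun x => complex.Im ((a +i* b) * F x)) =
    (fun x => a * complex.Im (F x) + b * complex.Re (F x)).
  by apply/funext => x; case: (F x).
rewrite (rsumD (Zoo a _ Roo) (Zoo (- b) _ Ioo)).
rewrite (rsumD (Zoo a _ Ioo) (Zoo b _ Roo)).
rewrite (rsumZ a Roo) (rsumZ (- b) Ioo) (rsumZ a Ioo) (rsumZ b Roo).
by rewrite mulNr.
Qed.

Lemma csum_le F (M : R) : (nnsum (fun x => cabs (F x)) <= M%:E)%E ->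
  cabs (csum F) <= 2 * M.
Proof.
move=> FM; apply: le_trans (cabs_le_ReIm _ _) _; rewrite mulr_natl mulr2n.
rewrite lerD// rsum_le// (le_trans _ FM)// le_nnsum// => x.
  exact: Re_le_cabs.
exact: Im_le_cabs.
Qed.
End csum.

Section ell2.
Variables (R : realType) (T : choiceType).
Implicit Types f g : T -> R[i].

Definition sqsum f : \bar R := nnsum (fun x => cabs (f x) ^+ 2).

Arguments sqsum f%_ring_scope.

Definition ell2_pred : {pred T -> R[i]} := [pred f | (sqsum f < +oo)%E].

Lemma sqsum_ge0 f : (0 <= sqsum f)%E.
Proof. by apply: nnsum_ge0 => x; rewrite sqr_ge0. Qed.

Lemma sqsum_fin f : (sqsum f < +oo)%E -> sqsum f \is a fin_num.
Proof. by move=> foo; rewrite ge0_fin_numE// sqsum_ge0. Qed.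

Lemma sqsumZ (c : R[i]) f : sqsum (c *: f) = ((cabs c ^+ 2)%:E * sqsum f)%E.
Proof.
rewrite /sqsum -nnsumZ ?sqr_ge0//; last by move=> x; rewrite sqr_ge0.
by apply: eq_nnsum => x; rewrite /= [(c *: f) x]/(c * f x) cabsM exprMn.
Qed.

Lemma sqsumD (t : R) f g : 0 < t ->
  (sqsum (f + g) <= (1 + t)%:E * sqsum f + (1 + t^-1)%:E * sqsum g)%E.
Proof.
move=> t0; have ti0 : 0 < t^-1 by rewrite invr_gt0.
rewrite /sqsum -!nnsumZ; first last.
- by move=> x; rewrite sqr_ge0.
- lra.
- by move=> x; rewrite sqr_ge0.
- lra.
rewrite -nnsumD; first last.
- by move=> x; rewrite mulr_ge0 ?sqr_ge0//; lra.
- by move=> x; rewrite mulr_ge0 ?sqr_ge0//; lra.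
apply: le_nnsum => x; rewrite [(f + g) x]/(f x + g x).
set a := cabs (f x); set b := cabs (g x).
have /(@le_trans _ _ ((a + b) ^+ 2)) : (a + b) ^+ 2 <=
    (1 + t) * a ^+ 2 + (1 + t^-1) * b ^+ 2.
  rewrite -subr_ge0.
  have -> : (1 + t) * a ^+ 2 + (1 + t^-1) * b ^+ 2 - (a + b) ^+ 2 =
    t * (a - t^-1 * b) ^+ 2 by field; rewrite gt_eqF.
  by rewrite mulr_ge0 ?sqr_ge0// ltW.
apply; rewrite lerXn2r ?nnegrE ?addr_ge0 ?cabs_ge0//.
exact: cabsD.
Qed.

Lemma sqsum0 : sqsum 0 = 0%E.
Proof.
rewrite /sqsum -[RHS](nnsum0 R T); apply: eq_nnsum => x.
by rewrite cabs0 expr0n.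
Qed.

Lemma sqsum_eq0 f : sqsum f = 0%E -> f = 0.
Proof.
move=> f0; apply/funext => x; apply: cabs_eq0; apply/eqP.
rewrite -sqrf_eq0 eq_le sqr_ge0 andbT.
have := nnsum_ge1 (f := fun x => cabs (f x) ^+ 2) x (fun=> sqr_ge0 _).
by rewrite -/(sqsum f) f0 lee_fin.
Qed.

Lemma ell2_submod_closed : submod_closed ell2_pred.
Proof.
split; first by rewrite inE /= sqsum0.
move=> c f g; rewrite !inE/= => foo goo.
apply: le_lt_trans (sqsumD _ _ ltr01) _.
have cfoo : (sqsum (c *: f) < +oo)%E.
  by rewrite sqsumZ lte_mul_pinfty// lee_fin sqr_ge0.
by rewrite invr1 lte_add_pinfty// lte_mul_pinfty// lee_fin; lra.
Qed.

HB.instance Definition _ :=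
  GRing.isSubmodClosed.Build _ _ ell2_pred ell2_submod_closed.

Record ell2 := Ell2 { ell2_fun :> T -> R[i]; _ : ell2_fun \in ell2_pred }.

HB.instance Definition _ := [isSub for ell2_fun].
HB.instance Definition _ := [Choice of ell2 by <:].
HB.instance Definition _ := [SubChoice_isSubLmodule of ell2 by <:].

End ell2.
Arguments sqsum {R T} f%_ring_scope.

Section ell2_normed.
Variables (R : realType) (T : choiceType).
Local Notation ell2 := (ell2 R T).
Implicit Types f g : ell2.

Lemma ell2P (f : ell2) : (sqsum f < +oo)%E.
Proof. by have := valP f; rewrite inE. Qed.

Definition ell2_rnorm (f : ell2) : R := Num.sqrt (fine (sqsum f)).

(* The norm of a normedModType R[i] is R[i]-valued. *)
Definition ell2_norm (f : ell2) : R[i] := (ell2_rnorm f)%:C.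

Lemma ell2_rnorm_ge0 f : 0 <= ell2_rnorm f.
Proof. exact: sqrtr_ge0. Qed.

Lemma ell2_rnorm_sqr f : (ell2_rnorm f ^+ 2)%:E = sqsum f.
Proof.
rewrite sqr_sqrtr ?fine_ge0 ?sqsum_ge0// fineK// sqsum_fin//.
exact: ell2P.
Qed.

Lemma ell2_rnorm_eq0 f : ell2_rnorm f = 0 -> f = 0.
Proof.
move=> f0; apply/val_inj/sqsum_eq0.
by rewrite -ell2_rnorm_sqr f0 expr0n.
Qed.

Lemma ell2_rnorm_le f (M : R) : 0 <= M -> (sqsum f <= (M ^+ 2)%:E)%E ->
  ell2_rnorm f <= M.
Proof.
move=> M0; rewrite -ell2_rnorm_sqr lee_fin => h.
by rewrite -(@ler_pXn2r _ 2) ?nnegrE ?ell2_rnorm_ge0.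
Qed.

Lemma ell2_normD f g : ell2_norm (f + g) <= ell2_norm f + ell2_norm g.
Proof.
rewrite /ell2_norm -rmorphD/= lecR.
have [f0|f0] := eqVneq (ell2_rnorm f) 0.
  by rewrite f0 (ell2_rnorm_eq0 f0) !add0r.
have [g0|g0] := eqVneq (ell2_rnorm g) 0.
  by rewrite g0 (ell2_rnorm_eq0 g0) !addr0.
have A0 : 0 < ell2_rnorm f by rewrite lt0r f0 ell2_rnorm_ge0.
have B0 : 0 < ell2_rnorm g by rewrite lt0r g0 ell2_rnorm_ge0.
apply: ell2_rnorm_le; first by rewrite addr_ge0 ?ell2_rnorm_ge0.
apply: le_trans (sqsumD _ _ (divr_gt0 B0 A0)) _.
rewrite -!ell2_rnorm_sqr -!EFinM -EFinD lee_fin invf_div.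
rewrite le_eqVlt; apply/orP; left; apply/eqP; field.
by rewrite f0 g0.
Qed.

Lemma ell2_normZ (c : R[i]) f : ell2_norm (c *: f) = `|c| * ell2_norm f.
Proof.
rewrite /ell2_norm cabsE -rmorphM/=; congr (_%:C).
apply/eqP; rewrite -(@eqrXn2 _ 2) ?mulr_ge0 ?cabs_ge0 ?ell2_rnorm_ge0//.
apply/eqP/EFin_inj; rewrite ell2_rnorm_sqr exprMn EFinM ell2_rnorm_sqr.
exact: sqsumZ.
Qed.

Lemma ell2_norm_eq0 f : ell2_norm f = 0 -> f = 0.
Proof. by move=> [/ell2_rnorm_eq0]. Qed.

HB.instance Definition _ :=
  Lmodule_isNormed.Build R[i] ell2 ell2_normD ell2_normZ ell2_norm_eq0.
End ell2_normed.

Section bop.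
Variables (R : realType) (V : normedModType R[i]).

Definition bop_pred : {pred V -> V} := [pred T : V -> V |
  `[< linear T /\ exists M : R, forall x, `|T x| <= M%:C * `|x| >] ].

Lemma bop_predP (T : V -> V) :
  reflect (linear T /\ exists M : R, forall x, `|T x| <= M%:C * `|x|)
          (T \in bop_pred).
Proof. exact: asboolP. Qed.

Lemma bop_submod_closed : submod_closed bop_pred.
Proof.
split.
  apply/bop_predP; split => [c x y|].
    have E z : (0 : V -> V) z = 0 by [].
    by rewrite !E scaler0 addr0.
  by exists 0 => x; rewrite mul0r normr0.
move=> c T S /bop_predP[linT [M TM]] /bop_predP[linS [N SN]].
apply/bop_predP; split => [d x y|].
  have E z : (c *: T + S) z = c *: T z + S z by [].
  rewrite !E linT linS !scalerDr !scalerA [c * d]mulrC.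
  by rewrite -!addrA; congr (_ + _); rewrite addrCA.
exists (cabs c * M + N) => x.
rewrite rmorphD rmorphM/= -cabsE mulrDl.
rewrite (le_trans (ler_normD _ _))// lerD// normrZ -mulrA.
by rewrite ler_wpM2l.
Qed.

HB.instance Definition _ :=
  GRing.isSubmodClosed.Build _ _ bop_pred bop_submod_closed.

(* Bounded linear operators on V.  Below they get composition as product and
   the operator norm, which is the source of their topology. *)
Record bop := Bop { bop_fun :> V -> V; _ : bop_fun \in bop_pred }.

HB.instance Definition _ := [isSub for bop_fun].
HB.instance Definition _ := [Choice of bop by <:].
HB.instance Definition _ := [SubChoice_isSubLmodule of bop by <:].

End bop.

Section bop_ring.
Variables (R : realType) (V : normedModType R[i]).
Local Notation bop := (bop V).
Implicit Types S T U : bop.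

Lemma bop_linear T : linear T.
Proof. by have /bop_predP[] := valP T. Qed.

Lemma bop_bounded T : exists M : R, forall x, `|T x| <= M%:C * `|x|.
Proof. by have /bop_predP[] := valP T. Qed.

Lemma bopD T (x y : V) : T (x + y) = T x + T y.
Proof. by have := bop_linear T 1 x y; rewrite !scale1r. Qed.

Lemma bop0 T : T (0 : V) = 0.
Proof.
by apply: (addrI (T 0)); rewrite -bopD !addr0.
Qed.

Lemma bopZ T (c : R[i]) (x : V) : T (c *: x) = c *: T x.
Proof. by have := bop_linear T c x 0; rewrite bop0 !addr0. Qed.

Lemma bop_id_subproof : (fun x : V => x) \in @bop_pred R V.
Proof.
by apply/bop_predP; split => //; exists 1 => x; rewrite mul1r.
Qed.

Definition bop_id : bop := Bop bop_id_subproof.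

Lemma bop_comp_subproof S T : (fun x => S (T x)) \in @bop_pred R V.
Proof.
apply/bop_predP; split.
  by move=> c x y; rewrite bop_linear bop_linear.
have [M SM] := bop_bounded S; have [N TN] := bop_bounded T.
exists (`|M| * N) => x; rewrite rmorphM/= -mulrA.
apply: (le_trans (SM _)).
apply: (@le_trans _ _ (`|M|%:C * `|T x|)).
  by rewrite ler_wpM2r// lecR ler_norm.
by rewrite ler_wpM2l// ler0c.
Qed.

Definition bop_comp S T : bop := Bop (bop_comp_subproof S T).

Lemma bop_compA : associative bop_comp.
Proof. by move=> S T U; apply/val_inj. Qed.

Lemma bop_id_l : left_id bop_id bop_comp.
Proof. by move=> T; apply/val_inj. Qed.

Lemma bop_id_r : right_id bop_id bop_comp.
Proof. by move=> T; apply/val_inj. Qed.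

Lemma bop_compDl : left_distributive bop_comp +%R.
Proof. by move=> S T U; apply/val_inj. Qed.

Lemma bop_compDr : right_distributive bop_comp +%R.
Proof. by move=> S T U; apply/val_inj/funext => x; exact: bopD. Qed.

HB.instance Definition _ := GRing.Zmodule_isPzRing.Build bop
  bop_compA bop_id_l bop_id_r bop_compDl bop_compDr.

Definition opnorm T : R :=
  sup [set complex.Re `|T x| | x in [set x : V | `|x| <= 1]].

Let vnormE (x : V) : `|x| = (complex.Re `|x|)%:C.
Proof. by rewrite RRe_real// normr_real. Qed.

Lemma has_sup_opnorm T :
  has_sup [set complex.Re `|T x| | x in [set x : V | `|x| <= 1]].
Proof.
split; first by exists (complex.Re `|T 0|); exists 0 => //=; rewrite normr0.
have [M TM] := bop_bounded T; exists `|M| => _ [x /= x1 <-].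
rewrite -lecR -vnormE (le_trans (TM x))//.
apply: (@le_trans _ _ (`|M|%:C * `|x|)).
  by rewrite ler_wpM2r// lecR ler_norm.
by rewrite -[leRHS]mulr1 ler_wpM2l// ler0c.
Qed.

Lemma opnorm_ge0 T : 0 <= opnorm T.
Proof.
rewrite -[leLHS](_ : complex.Re `|T 0| = 0); last by rewrite bop0 normr0.
by apply: (sup_upper_bound (has_sup_opnorm T)); exists 0 => //=; rewrite normr0.
Qed.

Lemma opnormP T (x : V) : `|T x| <= (opnorm T)%:C * `|x|.
Proof.
have [->|x0] := eqVneq x 0; first by rewrite bop0 !normr0 mulr0.
have nx0 : 0 < `|x| by rewrite normr_gt0.
rewrite -ler_pdivrMr// mulrC -[_^-1]ger0_norm ?invr_ge0// -normrZ -bopZ.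
rewrite [leLHS]vnormE lecR; apply: (sup_upper_bound (has_sup_opnorm T)).
exists (`|x|^-1 *: x) => //=.
by rewrite normrZ ger0_norm ?invr_ge0// mulVf ?lt0r_neq0.
Qed.

Lemma opnorm_le T (M : R) : 0 <= M -> (forall x, `|T x| <= M%:C * `|x|) ->
  opnorm T <= M.
Proof.
move=> M0 TM; apply: ge_sup; first by case: (has_sup_opnorm T).
move=> _ [x /= x1 <-]; rewrite -lecR -vnormE (le_trans (TM x))//.
by rewrite -[leRHS]mulr1 ler_wpM2l// ler0c.
Qed.

Lemma opnormD S T : (opnorm (S + T))%:C <= (opnorm S)%:C + (opnorm T)%:C.
Proof.
rewrite -rmorphD lecR; apply: opnorm_le; first by rewrite addr_ge0 ?opnorm_ge0.
move=> x; rewrite rmorphD mulrDl (le_trans (ler_normD _ _))//.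
by rewrite lerD// opnormP.
Qed.

Lemma opnorm_eq0 T : (opnorm T)%:C = 0 -> T = 0.
Proof.
move=> [T0]; apply/val_inj/funext => x; apply/eqP; rewrite -normr_le0.
by rewrite (le_trans (opnormP T x))// T0 mul0r.
Qed.

Lemma opnormZ_le (c : R[i]) T : opnorm (c *: T) <= cabs c * opnorm T.
Proof.
apply: opnorm_le; first by rewrite mulr_ge0 ?cabs_ge0 ?opnorm_ge0.
move=> x; have -> : (c *: T) x = c *: T x by [].
rewrite rmorphM/= -cabsE normrZ -mulrA.
by rewrite ler_wpM2l// opnormP.
Qed.

Lemma opnormZ (c : R[i]) T : (opnorm (c *: T))%:C = `|c| * (opnorm T)%:C.
Proof.
rewrite cabsE -rmorphM/=; congr (_%:C); apply/eqP; rewrite eq_le opnormZ_le/=.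
have [->|c0] := eqVneq c 0; first by rewrite cabs0 mul0r opnorm_ge0.
have cc0 : 0 < cabs c by rewrite -ltcR -cabsE normr_gt0.
rewrite -ler_pdivlMl//; have := opnormZ_le c^-1 (c *: T).
rewrite scalerA mulVf// scale1r; congr (_ <= _ * _).
by apply/(@complexI R); rewrite fmorphV/= -!cabsE normfV.
Qed.

HB.instance Definition _ :=
  Lmodule_isNormed.Build R[i] bop opnormD opnormZ opnorm_eq0.
End bop_ring.

Definition circle (R : realType) := {z : R[i] | `|z| == 1}.

Section twisted.
Variables (R : realType) (n : nat) (theta : 'M[circle R]_n).
Local Notation Zn := 'rV[int]_n.
Local Notation ell2 := (ell2 R Zn).

Definition ell1_pred : {pred Zn -> R[i]} :=
  [pred f | (nnsum (fun x => cabs (f x)) < +oo)%E].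

Record ell1 := Ell1 { ell1_fun :> Zn -> R[i]; _ : ell1_fun \in ell1_pred }.

HB.instance Definition _ := [isSub for ell1_fun].

Definition cocycle (l m : Zn) : R[i] :=
  \prod_(j < n) \prod_(k < n | (j < k)%N)
    sval (theta k j) ^ (l ord0 k * m ord0 j).

Definition tconv (f g : Zn -> R[i]) (x : Zn) : R[i] :=
  csum (fun y => f y * g (x - y) * cocycle y (x - y)).

Lemma cabs_cocycle l m : cabs (cocycle l m) = 1.
Proof.
apply/(@complexI R); rewrite -cabsE /cocycle normr_prod big1// => j _.
rewrite normr_prod big1// => k _; have /eqP t1 := valP (theta k j).
case: (_ * _) => a; first by rewrite normrX t1 expr1n.
by rewrite NegzE -exprnN normfV normrX t1 expr1n invr1.
Qed.

Lemma ell1P (f : ell1) : (nnsum (fun x => cabs (f x)) < +oo)%E.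
Proof. by have := valP f; rewrite inE. Qed.

Lemma nnsum_shift (h : Zn -> R) y : nnsum (fun x => h (x - y)) = nnsum h.
Proof.
rewrite /nnsum -(reindex_esum setT setT (fun x => x - y) (fun x => (h x)%:E))//.
split => //; first by move=> a b _ _ /addIr.
by move=> b _; exists (b + y) => //; rewrite addrK.
Qed.

Section young.
Variables (f : ell1) (g : ell2).
Let p y := cabs (f y).
Let u y := cabs (g y).
Let P := fine (nnsum p).
Let c := ell2_rnorm g.
Let V x := nnsum (fun y => p y * u (x - y) ^+ 2).

Let p0 y : 0 <= p y. Proof. exact: cabs_ge0. Qed.
Let u0 y : 0 <= u y. Proof. exact: cabs_ge0. Qed.
Let c0 : 0 <= c. Proof. exact: ell2_rnorm_ge0. Qed.
Let pu0 x y : 0 <= p y * u (x - y). Proof. by rewrite mulr_ge0. Qed.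
Let pu20 x y : 0 <= p y * u (x - y) ^+ 2.
Proof. by rewrite mulr_ge0// sqr_ge0. Qed.

Let PE : nnsum p = P%:E.
Proof. by rewrite fineK// fin_nnsum//; exact: ell1P. Qed.

Let P0 : 0 <= P. Proof. by rewrite fine_ge0// nnsum_ge0. Qed.

Let u_le y : u y <= c.
Proof.
rewrite -(@ler_pXn2r _ 2) ?nnegrE// -lee_fin ell2_rnorm_sqr.
by apply: (nnsum_ge1 (f := fun y => u y ^+ 2)) => z; rewrite sqr_ge0.
Qed.

Let tconv_absE x y :
  cabs (f y * g (x - y) * cocycle y (x - y)) = p y * u (x - y).
Proof. by rewrite !cabsM cabs_cocycle mulr1. Qed.

Let pu_le x : (nnsum (fun y => p y * u (x - y))%R <= (c * P)%:E)%E.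
Proof.
rewrite EFinM -PE -nnsumZ//; apply: le_nnsum => y.
by rewrite mulrC ler_wpM2r.
Qed.

Lemma tconv_summable x :
  (nnsum (fun y => cabs (f y * g (x - y) * cocycle y (x - y)))%R < +oo)%E.
Proof.
rewrite (eq_nnsum (tconv_absE x)).
by apply: le_lt_trans (pu_le x) _; rewrite ltry.
Qed.

Let V_fin x : V x \is a fin_num.
Proof.
apply: fin_nnsum => //; apply: (@le_lt_trans _ _ (c ^+ 2 * P)%:E); last first.
  by rewrite ltry.
rewrite EFinM -PE -nnsumZ ?sqr_ge0//; apply: le_nnsum => y.
by rewrite mulrC ler_wpM2r// lerXn2r ?nnegrE.
Qed.

Let V_sum : (\esum_(x in [set: Zn]) V x = (P * c ^+ 2)%:E)%E.
Proof.
rewrite nnsum_exchange//.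
transitivity (nnsum (fun y => c ^+ 2 * p y)).
  apply: eq_esum => y _; rewrite nnsumZ//; last by move=> x; rewrite sqr_ge0.
  by rewrite (nnsum_shift (fun x => u x ^+ 2)) EFinM ell2_rnorm_sqr muleC.
by rewrite nnsumZ ?sqr_ge0// PE -EFinM mulrC.
Qed.

Let tconv_sqr x : ((cabs (tconv f g x) ^+ 2)%:E <= (4 * (P + 1))%:E * V x)%E.
Proof.
set U := fine (nnsum (fun y => p y * u (x - y))).
have UE : nnsum (fun y => p y * u (x - y)) = U%:E.
  rewrite fineK// fin_nnsum//; apply: le_lt_trans (pu_le x) _.
  by rewrite ltry.
have U0 : 0 <= U by rewrite fine_ge0// nnsum_ge0.
have tU : cabs (tconv f g x) <= 2 * U.
  by apply: csum_le; rewrite (eq_nnsum (tconv_absE x)) UE.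
have VE : V x = (fine (V x))%:E by rewrite fineK.
have P1 : 0 < P + 1 by rewrite ltr_wpDl.
set s := U / (P + 1).
have s0 : 0 <= s by rewrite divr_ge0// ltW.
have s20 : 0 <= 2 * s by rewrite mulr_ge0.
have UV : 2 * s * U <= fine (V x) + s ^+ 2 * P.
  rewrite -lee_fin EFinD (EFinM (2 * s)) (EFinM (s ^+ 2)) -VE -PE -UE.
  rewrite -!nnsumZ ?sqr_ge0// -nnsumD//; last first.
    by move=> y; rewrite mulr_ge0 ?sqr_ge0.
  apply: le_nnsum => y; rewrite -subr_ge0.
  have -> : p y * u (x - y) ^+ 2 + s ^+ 2 * p y - 2 * s * (p y * u (x - y)) =
    p y * (u (x - y) - s) ^+ 2 by ring.
  by rewrite mulr_ge0 ?sqr_ge0.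
have sE : U = s * (P + 1) by rewrite divfK// gt_eqF.
have UV' : U ^+ 2 <= (P + 1) * fine (V x).
  have : s * U <= fine (V x).
    have sU : s ^+ 2 * P <= s * U.
      by rewrite expr2 -mulrA ler_wpM2l// sE mulrDr mulr1 lerDl.
    rewrite -(lerD2r (s * U)) (le_trans _ (le_trans UV _)) ?lerD2l//.
    by rewrite -mulrA mulr_natl mulr2n.
  by move=> h; rewrite expr2 {1}sE mulrAC mulrC ler_wpM2l// ltW.
rewrite VE -EFinM lee_fin -mulrA.
apply: (@le_trans _ _ ((2 * U) ^+ 2)).
  by rewrite lerXn2r ?nnegrE ?cabs_ge0// mulr_ge0.
have -> : (2 * U) ^+ 2 = 4 * U ^+ 2 by ring.
by rewrite ler_wpM2l.
Qed.

(* Weak form of Young's inequality l^1 * l^2 -> l^2, enough for boundedness. *)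
Lemma sqsum_tconv : (sqsum (tconv f g) <= ((2 * (P + 1) * c) ^+ 2)%:E)%E.
Proof.
apply: (@le_trans _ _ (4 * (P + 1) * (P * c ^+ 2))%:E); last first.
  rewrite lee_fin -subr_ge0.
  have -> : (2 * (P + 1) * c) ^+ 2 - 4 * (P + 1) * (P * c ^+ 2) =
    4 * (P + 1) * c ^+ 2 by ring.
  by rewrite mulr_ge0 ?sqr_ge0// mulr_ge0// addr_ge0.
rewrite EFinM -V_sum.
have VE x : V x = (fine (V x))%:E by rewrite fineK.
have -> : (\esum_(x in [set: Zn]) V x = nnsum (fun x => fine (V x)))%E.
  by apply: eq_esum => x _.
rewrite -nnsumZ; last first.
- by move=> x; rewrite fine_ge0// nnsum_ge0.
- by rewrite mulr_ge0// addr_ge0.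
apply: le_nnsum => x; have := tconv_sqr x.
by rewrite VE -EFinM lee_fin.
Qed.

Lemma tconv_ell2 : tconv f g \in @ell2_pred R Zn.
Proof. by rewrite inE/=; apply: le_lt_trans sqsum_tconv _; rewrite ltry. Qed.
End young.

(* The regular representation. *)
Definition lambda_fun (f : ell1) (g : ell2) : ell2 := Ell2 (tconv_ell2 f g).

Lemma lambda_subproof (f : ell1) : lambda_fun f \in @bop_pred R ell2.
Proof.
apply/bop_predP; split.
  move=> a g h; apply/val_inj/funext => x.
  rewrite -[LHS]/(tconv f (a *: g + h) x).
  rewrite -[RHS]/(a * tconv f g x + tconv f h x).
  have gS := tconv_summable f g x; have hS := tconv_summable f h x.
  have agS : (nnsum (fun y =>
      cabs (a * (f y * g (x - y) * cocycle y (x - y))))%R < +oo)%E.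
    rewrite (eq_nnsum (fun y => cabsM _ _)).
    by apply: nnsumZ_fin => // [|y]; exact: cabs_ge0.
  rewrite [in RHS]/tconv -(csumZ a gS) -(csumD agS hS).
  apply: eq_csum => y.
  have -> : (a *: g + h : ell2) (x - y) = a * g (x - y) + h (x - y) by [].
  by rewrite mulrDr mulrDl [f y * (a * _)]mulrCA -(mulrA a).
exists (2 * (fine (nnsum (fun y => cabs (f y))) + 1)) => g.
rewrite -[`|lambda_fun f g|]/((ell2_rnorm (lambda_fun f g))%:C).
rewrite -[`|g|]/((ell2_rnorm g)%:C) -rmorphM lecR.
apply: ell2_rnorm_le; last exact: sqsum_tconv.
rewrite !mulr_ge0 ?ell2_rnorm_ge0// addr_ge0// fine_ge0// nnsum_ge0// => y.
exact: cabs_ge0.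
Qed.

Definition lambda (f : ell1) : bop ell2 := Bop (lambda_subproof f).

(* l^1(Z^n, theta), as a subalgebra of the bounded operators on l^2(Z^n). *)
Definition ell1_alg : set (bop ell2) := range lambda.

(* C^*(theta), realized as the operator-norm closure of lambda(l^1(Z^n)). *)
Definition nc_torus : set (bop ell2) := closure ell1_alg.

End twisted.

(* For subalgebras A, B of E containing the identity of E, with A included
   in B; the conclusion A b says that the inverse of a lies in A. *)
Definition inverse_closed (E : pzRingType) (A B : set E) :=
  forall a b : E, A a -> B b -> a * b = 1 -> b * a = 1 -> A b.

(* Main.v *)
Require Import Defs.
From mathcomp Require Import all_boot all_order all_algebra.
From mathcomp Require Import complex.
From mathcomp Require Import all_classical all_reals all_analysis.
From mathcomp Require Import zify ring lra.

(** Let b be a bounded inverse of [lambda f].  Since [lambda f] commutes with the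
    twisted right translations, so does b, and an operator with that property is
    determined by its column g = b delta_0 ([lambda_of_column]).  So everything
    rests on the summability of g, for then b = lambda g.  The argument is that of
    Hulanicki for groups of polynomial growth, in a form which needs neither the
    spectral theorem nor an exchange of infinite sums.

    Cut [f] into its restriction to a finite set, which acts as an operator P, and
    a remainder of small l^1 norm, which acts as E.  The adjoint Q of P is again a
    finite combination of unimodular weighted shifts.  Being invertible,
    [lambda f] is bounded below, hence so is P, and p = 1 - t Q P is a strict
    contraction of l^2 for a suitable t > 0 ([gram_contraction]).  Put
    S = 1 - t Q (lambda f) = p - t Q E.  Then g = S g + t Q delta_0, and g is the
    sum of the Neumann series of the S^k (t Q delta_0).

    This series converges in l^2 because S contracts l^2; the point is that it
    converges in l^1.  The two terms of S are controlled in different ways.  The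
    operator p need not be small in l^1, but it contracts l^2 and enlarges
    supports by at most a fixed radius d.  The operator t Q E enlarges supports
    arbitrarily, but it is a combination with small l^1 norm of weighted shifts,
    and these preserve the l^2 norm and the shape of supports.  In a word of
    length k in the two operators, the supports therefore stay, up to
    translations, in boxes of radius O(k), which have O(k^n) points, and the l^1
    norm on such a box is at most the number of its points times the l^2 norm.
    Hence |S^k h|_1 <= (rho + eps)^k O(k^n) |h|_2 for h of finite support
    ([l1_bound_exp]), where rho < 1 bounds the norm of p and eps < 1 - rho is the
    size of t Q E, and the geometric factor wins ([neumann_l1]). *)

Set Implicit Arguments.
Unset Strict Implicit.
Unset Printing Implicit Defensive.

Import Order.TTheory GRing.Theory Num.Theory.
Import numFieldNormedType.Exports.

Local Open Scope classical_set_scope.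
Local Open Scope ring_scope.

(** * Sums of families *)

Section FamilySums.
Variables (R : realType) (T : choiceType).

(** Bounds on infinite sums are proved below by testing finite lists, so that no
    exchange of infinite sums is ever needed. *)
Lemma nnsum_leP (f : T -> R) (M : R) : (forall x, 0 <= f x) ->
  (nnsum f <= M%:E)%E <-> (forall s, uniq s -> \sum_(x <- s) f x <= M).
Proof.
move=> f0; split=> [fM s us|fM].
  rewrite -lee_fin (le_trans _ fM)// /nnsum.
  apply: esum_ge; exists [set` s]; first by split => //; exact: finite_set_seq.
  by rewrite -fsbig_seq// sumEFin.
apply: ge_ereal_sup => _ [A [finA _] <-].
by rewrite fsbig_finite//= sumEFin lee_fin fM.
Qed.

Lemma nnsum_eq_single (f : T -> R) x0 : (forall x, 0 <= f x) ->
  (forall x, x != x0 -> f x = 0) -> nnsum f = (f x0)%:E.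
Proof.
move=> f0 fx; apply/eqP; rewrite eq_le nnsum_ge1// andbT.
apply/nnsum_leP => // s us.
have [xs|xs] := boolP (x0 \in s).
  rewrite (bigD1_seq x0)//= big1 ?addr0// => x; exact: fx.
rewrite big_seq big1 => [|x xin]; first exact: f0.
by apply: fx; apply: contraNneq xs => <-.
Qed.

Lemma nnsum_tail (f : T -> R) (e : R) : (forall x, 0 <= f x) ->
  (nnsum f < +oo)%E -> 0 < e ->
  exists2 s, uniq s & (nnsum (fun x => if x \in s then 0 else f x)%R <= e%:E)%E.
Proof.
move=> f0 foo e0; set M := fine (nnsum f).
have ME : nnsum f = M%:E by rewrite fineK// fin_nnsum.
have [s [us sM]] : exists s, uniq s /\ M - e < \sum_(x <- s) f x.
  apply: contrapT => h.
  have : (nnsum f <= (M - e)%:E)%E.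
    apply/nnsum_leP => // s us; rewrite leNgt; apply/negP => sM.
    by apply: h; exists s.
  by rewrite ME lee_fin; lra.
exists s => //; apply/nnsum_leP => [x|s' us']; first by case: ifP.
have fM : (nnsum f <= M%:E)%E by rewrite ME.
have := (nnsum_leP M f0).1 fM (s ++ [seq x <- s' | x \notin s]).
rewrite big_cat/= cat_uniq us filter_uniq// andbT/= big_filter.
have -> : ~~ has (in_mem^~ (mem s)) [seq x <- s' | x \notin s].
  by apply/hasPn => x /=; rewrite mem_filter => /andP[].
move=> /(_ isT).
have -> : \sum_(x <- s' | x \notin s) f x =
    \sum_(x <- s') if x \in s then 0 else f x.
  by rewrite big_mkcond; apply: eq_bigr => x _; case: (x \in s).
by lra.
Qed.

Lemma csum_eq_single (F : T -> R[i]) x0 :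
  (forall x, x != x0 -> F x = 0) -> csum F = F x0.
Proof.
have rs (u : T -> R) : (forall x, x != x0 -> u x = 0) -> rsum u = u x0.
  move=> ux; rewrite /rsum.
  rewrite (@nnsum_eq_single (fun x => Num.max (u x) 0) x0); first last.
  - by move=> x /ux ->; rewrite maxxx.
  - by move=> x; exact: max0_ge0.
  rewrite (@nnsum_eq_single (fun x => Num.max (- u x) 0) x0); first last.
  - by move=> x /ux ->; rewrite oppr0 maxxx.
  - by move=> x; exact: max0_ge0.
  exact: max0B.
move=> Fx; rewrite /csum !rs; first by case: (F x0).
- by move=> x /Fx ->.
- by move=> x /Fx ->.
Qed.

Lemma csum_cut (F : T -> R[i]) s : uniq s ->
  (nnsum (fun x => cabs (F x)) < +oo)%E ->
  csum F = \sum_(x <- s) F x + csum (fun x => if x \in s then 0 else F x).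
Proof.
move=> + Foo; elim: s => [_|x0 s IH /= /andP[x0s us]].
  by rewrite big_nil add0r; exact: eq_csum.
rewrite IH// big_cons -addrA [RHS]addrCA; congr (_ + _).
have <- : csum (fun x => if x == x0 then F x else 0) = F x0.
  by rewrite (@csum_eq_single _ x0) ?eqxx// => x /negbTE ->.
rewrite -csumD.
- apply: eq_csum => x; rewrite inE; case: eqP => [->|_] /=.
    by rewrite (negbTE x0s) addr0.
  by rewrite add0r.
- apply: le_lt_trans Foo; apply: le_nnsum => x.
  by case: ifP => // _; rewrite cabs0 cabs_ge0.
- apply: le_lt_trans Foo; apply: le_nnsum => x.
  by case: ifP => // _; rewrite cabs0 cabs_ge0.
Qed.

End FamilySums.

(** * Bounded operators on l^2 and their adjoints *)

Section Ell2.
Variables (R : realType) (T : choiceType).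
Local Notation ell2 := (ell2 R T).
Implicit Types (g h : ell2) (S : bop ell2).

Lemma ell2_rnormE h : `|h| = ((ell2_rnorm h)%:C)%C.
Proof. by []. Qed.

Lemma ell2_rnormD g h : ell2_rnorm (g + h) <= ell2_rnorm g + ell2_rnorm h.
Proof. by rewrite -lecR rmorphD/= -!ell2_rnormE ler_normD. Qed.

Lemma ell2_rnormZ (c : R[i]) h : ell2_rnorm (c *: h) = cabs c * ell2_rnorm h.
Proof.
by apply/(@complexI R); rewrite rmorphM/= -!ell2_rnormE -cabsE normrZ.
Qed.

Lemma ell2_rnorm0 : ell2_rnorm (0 : ell2) = 0.
Proof. by apply/(@complexI R); rewrite -ell2_rnormE normr0. Qed.

Lemma ell2_rnorm_sum (I : Type) (s : seq I) (h : I -> ell2) :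
  ell2_rnorm (\sum_(i <- s) h i) <= \sum_(i <- s) ell2_rnorm (h i).
Proof.
elim/big_ind2: _ => [|x a y b xa yb|//]; first by rewrite ell2_rnorm0.
by rewrite (le_trans (ell2_rnormD _ _))// lerD.
Qed.

Lemma ell2DE g h z : (g + h) z = g z + h z.
Proof. by []. Qed.

Lemma ell2NE g z : (- g) z = - g z.
Proof. by []. Qed.

Lemma ell2ZE (c : R[i]) h z : (c *: h) z = c * h z.
Proof. by []. Qed.

Lemma ell2_sumE (I : Type) (s : seq I) (h : I -> ell2) z :
  (\sum_(i <- s) h i) z = \sum_(i <- s) h i z.
Proof. by elim/big_ind2: _ => [//|x a y b <- <-|//]. Qed.

Lemma cabs_le_ell2 h z : cabs (h z) <= ell2_rnorm h.
Proof.
rewrite -(@ler_pXn2r _ 2) ?nnegrE ?cabs_ge0 ?ell2_rnorm_ge0//.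
rewrite -lee_fin ell2_rnorm_sqr.
by apply: (nnsum_ge1 (f := fun x => cabs (h x) ^+ 2)) => x; rewrite sqr_ge0.
Qed.

Lemma bop_rnorm_le S h : ell2_rnorm (S h) <= opnorm S * ell2_rnorm h.
Proof. by rewrite -lecR rmorphM/= -!ell2_rnormE opnormP. Qed.

Lemma bopDE S1 S2 h : (S1 + S2) h = S1 h + S2 h. Proof. by []. Qed.
Lemma bopNE S h : (- S) h = - S h. Proof. by []. Qed.
Lemma bopZE (c : R[i]) S h : (c *: S) h = c *: S h. Proof. by []. Qed.
Lemma bopME S1 S2 h : (S1 * S2) h = S1 (S2 h). Proof. by []. Qed.
Lemma bop1E h : (1 : bop ell2) h = h. Proof. by []. Qed.

Lemma bop_ext S1 S2 : (forall h x, S1 h x = S2 h x) -> S1 = S2.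
Proof.
by move=> S12; apply/val_inj/funext => h; apply/val_inj/funext => x; exact: S12.
Qed.

Lemma bop_sumE (I : Type) (s : seq I) (S : I -> bop ell2) h :
  (\sum_(i <- s) S i) h = \sum_(i <- s) S i h.
Proof. by elim/big_ind2: _ => [//|x a y b <- <-|//]. Qed.

Lemma bopN S h : S (- h) = - S h.
Proof. by rewrite -scaleN1r bopZ scaleN1r. Qed.

Lemma bopB S g h : S (g - h) = S g - S h.
Proof. by rewrite bopD bopN. Qed.

Lemma bop_sum S (I : Type) (s : seq I) (h : I -> ell2) :
  S (\sum_(i <- s) h i) = \sum_(i <- s) S (h i).
Proof. by elim/big_rec2: _ => [|i x y _ <-]; rewrite ?bop0 ?bopD. Qed.

Lemma scalebopAr (c : R[i]) S1 S2 : S1 * (c *: S2) = c *: (S1 * S2).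
Proof. by apply/val_inj/funext => h; apply: (bopZ S1 c (S2 h)). Qed.

(** The real part of the inner product: real bilinearity and the value of
    [re_inner h h] are all that norm estimates require. *)
Definition re_inner g h : R := rsum (fun x =>
  complex.Re (g x) * complex.Re (h x) + complex.Im (g x) * complex.Im (h x)).

Let cabs_sqr (z : R[i]) :
  cabs z ^+ 2 = complex.Re z ^+ 2 + complex.Im z ^+ 2.
Proof.
by rewrite /cabs normc_def/= sqr_sqrtr// addr_ge0 ?sqr_ge0.
Qed.

Lemma re_inner_summable g h : (nnsum (fun x => `|complex.Re (g x) *
  complex.Re (h x) + complex.Im (g x) * complex.Im (h x)|%R) < +oo)%E.
Proof.
apply: (@le_lt_trans _ _ (sqsum g + sqsum h)%E); last first.
  by rewrite lte_add_pinfty ?ell2P.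
rewrite -nnsumD; [|by move=> x; rewrite sqr_ge0..].
apply: le_nnsum => x; rewrite !cabs_sqr ler_norml.
case: (g x) (h x) => a b [c d] /=.
have := sqr_ge0 (a - c); have := sqr_ge0 (b - d).
have := sqr_ge0 (a + c); have := sqr_ge0 (b + d).
have := sqr_ge0 a; have := sqr_ge0 b; have := sqr_ge0 c; have := sqr_ge0 d.
by nra.
Qed.

Lemma re_innerC g h : re_inner g h = re_inner h g.
Proof.
by congr rsum; apply/funext => x; rewrite mulrC [X in _ + X = _]mulrC.
Qed.

Lemma re_innerDr g h k : re_inner g (h + k) = re_inner g h + re_inner g k.
Proof.
rewrite /re_inner -rsumD; try exact: re_inner_summable.
congr rsum; apply/funext => x; rewrite ell2DE.
by case: (g x) (h x) (k x) => ? ? [? ?] [? ?] /=; ring.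
Qed.

Lemma re_innerZr (c : R) g h :
  re_inner g ((c%:C)%C *: h) = c * re_inner g h.
Proof.
rewrite /re_inner -rsumZ; try exact: re_inner_summable.
congr rsum; apply/funext => x; rewrite ell2ZE.
by case: (g x) (h x) => ? ? [? ?] /=; ring.
Qed.

Lemma re_innerDl g h k : re_inner (g + h) k = re_inner g k + re_inner h k.
Proof. by rewrite re_innerC re_innerDr !(re_innerC k). Qed.

Lemma re_innerZl (c : R) g h :
  re_inner ((c%:C)%C *: g) h = c * re_inner g h.
Proof. by rewrite re_innerC re_innerZr (re_innerC h). Qed.

Lemma re_innerZ_conj (c : R[i]) g h :
  re_inner (c *: g) h = re_inner g ((c^*)%C *: h).
Proof.
congr rsum; apply/funext => x; rewrite !ell2ZE.
by case: c (g x) (h x) => ? ? [? ?] [? ?] /=; ring.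
Qed.

Lemma re_inner0l h : re_inner 0 h = 0.
Proof. by rewrite -(scale0r 0) (re_innerZl 0) mul0r. Qed.

Lemma re_inner0r h : re_inner h 0 = 0.
Proof. by rewrite re_innerC re_inner0l. Qed.

Lemma re_inner_sqr h : re_inner h h = ell2_rnorm h ^+ 2.
Proof.
apply: EFin_inj; rewrite ell2_rnorm_sqr /re_inner.
rewrite (@rsumE _ _ _ (fun x => cabs (h x) ^+ 2) (fun=> 0)) ?nnsum0 ?subr0//.
- by rewrite fineK// sqsum_fin// ell2P.
- by move=> x; rewrite sqr_ge0.
- exact: ell2P.
- by move=> x; rewrite subr0 cabs_sqr.
Qed.

Definition re_adjoint S S' := forall g h, re_inner (S g) h = re_inner g (S' h).

Lemma re_adjointZ (c : R[i]) S S' : re_adjoint S S' ->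
  re_adjoint (c *: S) ((c^*)%C *: S').
Proof.
by move=> adS g h; rewrite !bopZE re_innerZ_conj adS bopZ.
Qed.

Lemma re_adjoint_sum (I : Type) (s : seq I) (S S' : I -> bop ell2) :
  (forall i, re_adjoint (S i) (S' i)) ->
  re_adjoint (\sum_(i <- s) S i) (\sum_(i <- s) S' i).
Proof.
move=> adS g h; rewrite !bop_sumE; elim: s => [|i s IH].
  by rewrite !big_nil re_inner0l re_inner0r.
by rewrite !big_cons re_innerDl re_innerDr adS IH.
Qed.

(** One step of gradient descent for |S h|^2 contracts as soon as [S] is bounded
    below.  Expanding the square, with [t = k ^- 2],
      |h - t S' S h|^2 = |h|^2 - 2 t |S h|^2 + t^2 |S' S h|^2
                       <= |h|^2 - t |S h|^2 <= (1 - t b^2) |h|^2,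
    and 1 - t b^2 <= (1 - t b^2 / 2)^2.  This replaces the spectral theorem for
    the positive operator [S' * S]. *)
Lemma gram_contraction S S' (k b : R) : re_adjoint S S' ->
  0 < k -> b <= k -> 0 <= b ->
  (forall h, ell2_rnorm (S' h) <= k * ell2_rnorm h) ->
  (forall h, b * ell2_rnorm h <= ell2_rnorm (S h)) ->
  forall h, ell2_rnorm ((1 - ((k ^- 2)%:C)%C *: (S' * S)) h)
    <= (1 - k ^- 2 * b ^+ 2 / 2) * ell2_rnorm h.
Proof.
move=> adS k0 bk b0 S'k Sb h.
have k0' := ltW k0; set t := k ^- 2; set N := ell2_rnorm h.
have t0 : 0 <= t by rewrite invr_ge0 sqr_ge0.
have tk : t * k ^+ 2 = 1 by rewrite mulVf// sqrf_eq0 gt_eqF.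
have tb : t * b ^+ 2 <= 1 by rewrite -tk ler_wpM2l// lerXn2r// nnegrE// ltW.
have tb0 : 0 <= t * b ^+ 2 by rewrite mulr_ge0// sqr_ge0.
have N0 : 0 <= N := ell2_rnorm_ge0 h.
rewrite -(@ler_pXn2r _ 2) ?nnegrE ?ell2_rnorm_ge0//; last first.
  by rewrite mulr_ge0//; lra.
rewrite bopDE bop1E bopNE bopZE bopME -re_inner_sqr.
set q := S' (S h).
have -> : h - (t%:C)%C *: q = h + ((- t)%:C)%C *: q by rewrite rmorphN scaleNr.
rewrite re_innerDl !re_innerDr !re_innerZl !re_innerZr (re_innerC q h).
rewrite -!(adS h) !re_inner_sqr -/N.
set M := ell2_rnorm (S h).
have qM : ell2_rnorm q ^+ 2 <= k ^+ 2 * M ^+ 2.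
  by rewrite -exprMn lerXn2r ?nnegrE ?mulr_ge0 ?ell2_rnorm_ge0// S'k.
have MN : b ^+ 2 * N ^+ 2 <= M ^+ 2.
  by rewrite -exprMn lerXn2r ?nnegrE ?mulr_ge0 ?ell2_rnorm_ge0// Sb.
have h1 : t * (t * ell2_rnorm q ^+ 2) <= t * M ^+ 2.
  rewrite ler_wpM2l// -[leRHS]mul1r -tk -mulrA ler_wpM2l//.
have h2 : t * (b ^+ 2 * N ^+ 2) <= t * M ^+ 2 by rewrite ler_wpM2l.
have h3 : 0 <= (t * b ^+ 2) ^+ 2 * N ^+ 2 by rewrite mulr_ge0 ?sqr_ge0.
have -> : ((1 - t * b ^+ 2 / 2) * N) ^+ 2 = N ^+ 2 - t * (b ^+ 2 * N ^+ 2)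
  + (t * b ^+ 2) ^+ 2 * N ^+ 2 / 4 by field.
by lra.
Qed.

End Ell2.

(** * Weighted shifts and the regular representation *)

Section WeightedShift.
Variables (R : realType) (n : nat).
Local Notation Zn := 'rV[int]_n.
Local Notation ell2 := (ell2 R Zn).

Section Def.
Variables (x : Zn) (w : Zn -> R[i]).
Hypothesis w1 : forall z, cabs (w z) = 1.

Lemma sqsum_wshift (g : ell2) : sqsum (fun z => w z * g (z - x)) = sqsum g.
Proof.
rewrite /sqsum -(nnsum_shift (fun z => cabs (g z) ^+ 2) x).
by apply: eq_nnsum => z; rewrite cabsM w1 mul1r.
Qed.

Lemma wshift_ell2 (g : ell2) : (fun z => w z * g (z - x)) \in @ell2_pred R Zn.
Proof. by rewrite inE/= sqsum_wshift ell2P. Qed.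

Definition wshift_fun (g : ell2) : ell2 := Ell2 (wshift_ell2 g).

Lemma wshift_rnorm (g : ell2) : ell2_rnorm (wshift_fun g) = ell2_rnorm g.
Proof. by rewrite /ell2_rnorm sqsum_wshift. Qed.

Lemma wshift_bop : wshift_fun \in @bop_pred R ell2.
Proof.
apply/bop_predP; split => [c g h|]; last first.
  by exists 1 => g; rewrite mul1r !ell2_rnormE wshift_rnorm.
apply/val_inj/funext => z /=.
rewrite -[RHS]/(c * (w z * g (z - x)) + w z * h (z - x)).
rewrite -[LHS]/(w z * (c * g (z - x) + h (z - x))).
by rewrite mulrDr mulrCA.
Qed.

(** Twisted left translations, their adjoints and twisted right translations are
    all shifts with a unimodular weight.  Estimates that see only supports and
    absolute values can therefore be made once, for an arbitrary weight. *)
Definition wshift : bop ell2 := Bop wshift_bop.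

Lemma wshiftE g z : wshift g z = w z * g (z - x).
Proof. by []. Qed.

End Def.

Lemma cabs_conj (z : R[i]) : cabs (z^*)%C = cabs z.
Proof. by case: z => a b; rewrite /cabs !normc_def/= sqrrN. Qed.

Lemma rsum_shift (u : Zn -> R) x : rsum (fun z => u (z - x)) = rsum u.
Proof.
rewrite /rsum; congr (fine _ - fine _).
  exact: (nnsum_shift (fun z => Num.max (u z) 0)).
exact: (nnsum_shift (fun z => Num.max (- u z) 0)).
Qed.

Lemma wshift_adjoint x w (w1 : forall z, cabs (w z) = 1)
    (w1' : forall z, cabs ((w (z + x))^*)%C = 1) :
  re_adjoint (wshift x w1) (wshift (- x) w1').
Proof.
move=> g h; rewrite /re_inner -[RHS](rsum_shift _ x).
congr rsum; apply/funext => z; rewrite !wshiftE opprK subrK.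
by case: (w z) (g (z - x)) (h z) => ? ? [? ?] [? ?] /=; ring.
Qed.

End WeightedShift.

Section RegularRepresentation.
Variables (R : realType) (n : nat) (theta : 'M[circle R]_n).
Local Notation Zn := 'rV[int]_n.
Local Notation ell2 := (ell2 R Zn).
Local Notation ell1 := (ell1 R n).
Local Notation cocycle := (cocycle theta).
Local Notation lambda := (lambda theta).

Let theta_neq0 j k : sval (theta j k) != 0.
Proof. by rewrite -normr_eq0 (eqP (valP (theta j k))) oner_eq0. Qed.

Lemma cocycleDl l l' m : cocycle (l + l') m = cocycle l m * cocycle l' m.
Proof.
rewrite /Defs.cocycle -big_split; apply: eq_bigr => j _ /=.
rewrite -big_split; apply: eq_bigr => k _ /=.
by rewrite mxE mulrDl expfzDr.
Qed.

Lemma cocycleDr l m m' : cocycle l (m + m') = cocycle l m * cocycle l m'.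
Proof.
rewrite /Defs.cocycle -big_split; apply: eq_bigr => j _ /=.
rewrite -big_split; apply: eq_bigr => k _ /=.
by rewrite mxE mulrDr expfzDr.
Qed.

Lemma cocycle0l m : cocycle 0 m = 1.
Proof.
by rewrite /Defs.cocycle big1// => j _; rewrite big1// => k _; rewrite mxE mul0r.
Qed.

Lemma cocycle0r l : cocycle l 0 = 1.
Proof.
by rewrite /Defs.cocycle big1// => j _; rewrite big1// => k _; rewrite mxE mulr0.
Qed.

(** Left twisted convolution with the point mass at [x]; it is unitary. *)
Definition lshift x : bop ell2 :=
  wshift x (fun z => cabs_cocycle theta x (z - x)).

(** Right twisted convolution with the point mass at [y]. *)
Definition rshift y : bop ell2 :=
  wshift y (fun z => cabs_cocycle theta (z - y) y).

Lemma lambdaE f (g : ell2) z : lambda f g z = tconv theta f g z.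
Proof. by []. Qed.

(** Associativity of the twisted convolution, with a point mass on the right;
    it comes down to the fact that [cocycle] is a bicharacter. *)
Lemma lambda_rshift f y : lambda f * rshift y = rshift y * lambda f.
Proof.
apply: bop_ext => g z; rewrite !bopME wshiftE !lambdaE /tconv -csumZ;
  last exact: tconv_summable.
apply: eq_csum => u; rewrite wshiftE.
have -> : z - u - y = z - y - u by rewrite addrAC.
have -> : z - u = z - y - u + y by rewrite -[z in LHS](subrK y) addrAC.
have -> : cocycle (z - y) y = cocycle (z - y - u) y * cocycle u y.
  by rewrite -cocycleDl subrK.
by rewrite cocycleDr; ring.
Qed.

Lemma ell1_cutoff_proof (f : ell1) (s : seq Zn) :
  (fun x => if x \in s then 0 else f x) \in @ell1_pred R n.
Proof.
rewrite inE/=; apply: le_lt_trans (ell1P f); apply: le_nnsum => x.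
by case: ifP; rewrite // cabs0 cabs_ge0.
Qed.

Definition cutoff f s : ell1 := Ell1 (ell1_cutoff_proof f s).

Lemma lambda_cutoff f s : uniq s ->
  lambda f = \sum_(x <- s) f x *: lshift x + lambda (cutoff f s).
Proof.
move=> us; apply: bop_ext => g z; rewrite bopDE ell2DE.
rewrite !lambdaE bop_sumE ell2_sumE /tconv (csum_cut us);
  last exact: tconv_summable.
congr (_ + _).
  by apply: eq_bigr => x _; rewrite bopZE ell2ZE wshiftE; ring.
by apply: eq_csum => x /=; case: ifP => //; rewrite !mul0r.
Qed.

Definition l1norm (f : ell1) : R := fine (nnsum (fun x => cabs (f x))).

Lemma l1normE (f : ell1) : nnsum (fun x => cabs (f x)) = (l1norm f)%:E.
Proof.
by rewrite fineK// fin_nnsum ?ell1P// => x; exact: cabs_ge0.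
Qed.

Lemma l1norm_ge0 f : 0 <= l1norm f.
Proof. by rewrite fine_ge0// nnsum_ge0// => x; exact: cabs_ge0. Qed.

Lemma l1norm_sum (f : ell1) s : uniq s -> \sum_(x <- s) cabs (f x) <= l1norm f.
Proof.
move: s; apply/nnsum_leP; first by move=> x; exact: cabs_ge0.
by rewrite l1normE.
Qed.

Lemma l1norm_tail (f : ell1) (e : R) : 0 < e ->
  exists2 s, uniq s & l1norm (cutoff f s) <= e.
Proof.
move=> e0; have [s us se] := nnsum_tail (fun x => cabs_ge0 (f x)) (ell1P f) e0.
exists s => //; rewrite -lee_fin -l1normE.
apply: le_trans se; apply: le_nnsum => x /=.
by case: ifP; rewrite // cabs0.
Qed.

(** [sqsum_tconv] gives the inhomogeneous bound 2 (|f|_1 + 1) |g|_2.  Applied to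
    the multiples k f and divided by k, it loses the additive constant in the
    limit; without that, small [f] would not act as small operators. *)
Lemma lambda_rnorm_le f (g : ell2) :
  ell2_rnorm (lambda f g) <= 2 * l1norm f * ell2_rnorm g.
Proof.
have scaled (k : nat) : (0 < k)%N ->
    k%:R * ell2_rnorm (lambda f g) <= 2 * (k%:R * l1norm f + 1) * ell2_rnorm g.
  move=> k0.
  have kE x : cabs ((k%:R : R[i]) * f x) = k%:R * cabs (f x).
    by rewrite cabsM; congr (_ * _); rewrite /cabs normr_nat raddfMn/=.
  have kf1 : (nnsum (fun x => cabs ((k%:R : R[i]) * f x))%R < +oo)%E.
    rewrite (eq_nnsum kE); apply: nnsumZ_fin => // [x|].
      exact: cabs_ge0.
    exact: ell1P.
  have kfP : (fun x => (k%:R : R[i]) * f x) \in @ell1_pred R n by rewrite inE.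
  pose kf : ell1 := Ell1 kfP.
  have kl : l1norm kf = k%:R * l1norm f.
    apply: EFin_inj; rewrite -l1normE/= (eq_nnsum kE) nnsumZ//.
      by rewrite EFinM l1normE.
    by move=> x; exact: cabs_ge0.
  have lkf : lambda kf g = (k%:R : R[i]) *: lambda f g.
    apply/val_inj/funext => z.
    rewrite -[RHS]/(k%:R * tconv theta f g z) -[LHS]/(tconv theta kf g z).
    rewrite /tconv -csumZ; last exact: tconv_summable.
    by apply: eq_csum => x /=; ring.
  have <- : ell2_rnorm (lambda kf g) = k%:R * ell2_rnorm (lambda f g).
    rewrite lkf ell2_rnormZ; congr (_ * _).
    by rewrite /cabs normr_nat raddfMn/=.
  rewrite -kl; apply: ell2_rnorm_le; last exact: sqsum_tconv.
  by rewrite !mulr_ge0 ?ell2_rnorm_ge0// addr_ge0// l1norm_ge0.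
rewrite leNgt; apply/negP => h.
set d := ell2_rnorm (lambda f g) - 2 * l1norm f * ell2_rnorm g.
have d0 : 0 < d by rewrite subr_gt0.
pose k := Num.truncn (2 * ell2_rnorm g / d).
have := scaled k.+1 isT; apply/negP; rewrite -ltNge -subr_gt0.
have -> : k.+1%:R * ell2_rnorm (lambda f g) -
    2 * (k.+1%:R * l1norm f + 1) * ell2_rnorm g =
    k.+1%:R * d - 2 * ell2_rnorm g by rewrite /d; ring.
rewrite subr_gt0 -ltr_pdivrMr//; exact: truncnS_gt.
Qed.

End RegularRepresentation.

(** * Propagation of supports and l^1 bounds *)

Section Localization.
Variables (R : realType) (n : nat).
Local Notation Zn := 'rV[int]_n.
Local Notation ell2 := (ell2 R Zn).
Implicit Types (A B p : bop ell2) (D d : nat) (c : Zn) (h : ell2).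

Definition box c D (z : Zn) := [forall i, `|z ord0 i - c ord0 i| <= D%:Z].

Lemma box_add c c' D D' z z' :
  box c D z -> box c' D' z' -> box (c + c') (D + D') (z + z').
Proof.
move=> /forallP zD /forallP zD'; apply/forallP => i; rewrite !mxE.
rewrite opprD addrACA PoszD (le_trans (ler_normD _ _))//.
by rewrite lerD ?zD ?zD'.
Qed.

Lemma box_opp D z : box 0 D z -> box 0 D (- z).
Proof.
move=> /forallP zD; apply/forallP => i; have := zD i.
by rewrite !mxE !subr0 normrN.
Qed.

Lemma box_le c D D' z : (D <= D')%N -> box c D z -> box c D' z.
Proof.
move=> DD' /forallP zD; apply/forallP => i.
by rewrite (le_trans (zD i))// lez_nat.
Qed.

Lemma box_seq (s : seq Zn) : exists d, forall x, x \in s -> box 0 d x.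
Proof.
exists (\sum_(x <- s) \sum_(i < n) `|x ord0 i|%N)%N => x xs.
apply/forallP => i; rewrite mxE subr0 -abszE lez_nat.
rewrite (big_rem x)//= (bigD1 i)//= -addnA leq_addr//.
Qed.

Lemma size_box c D (s : seq Zn) : uniq s -> all (box c D) s ->
  (size s <= (2 * D + 1) ^ n)%N.
Proof.
move=> us /allP sD.
(* A point of the box is coded by its coordinates relative to the corner
   [c - D], which lie between 0 and 2 D. *)
pose code (z : Zn) : {ffun 'I_n -> 'I_(2 * D).+1} :=
  [ffun i => inord (absz (z ord0 i - c ord0 i + D%:Z))].
have absE (k : int) : `|k| <= D%:Z ->
    (absz (k + D%:Z))%:Z = k + D%:Z /\ (absz (k + D%:Z)%R < (2 * D).+1)%N.
  by lia.
have inj : {in s &, injective code}.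
  move=> z z' /sD /forallP zD /sD /forallP zD' /ffunP zz'.
  apply/rowP => i; have [e l] := absE _ (zD i); have [e' l'] := absE _ (zD' i).
  move: (zz' i); rewrite !ffunE => /(congr1 val); rewrite /= !inordK//.
  by move=> /(congr1 Posz); rewrite e e' => /addIr /addIr.
rewrite -(size_map code) -(card_uniqP _) ?map_inj_in_uniq//.
apply: leq_trans (max_card _) _.
by rewrite card_ffun !card_ord addn1.
Qed.

Definition localized c D h := forall z, ~~ box c D z -> h z = 0.

Lemma localized_sum (I : eqType) (s : seq I) (h : I -> ell2) c D :
  (forall i, i \in s -> localized c D (h i)) ->
  localized c D (\sum_(i <- s) h i).
Proof.
move=> sD z zD; rewrite ell2_sumE big_seq big1// => i /sD; exact.
Qed.

Lemma localized_le c D D' h : (D <= D')%N -> localized c D h ->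
  localized c D' h.
Proof. by move=> DD' hD z zD; apply: hD; apply: contra zD; exact: box_le. Qed.

Lemma localized_wshift x w (w1 : forall z, cabs (w z) = 1) c D h :
  localized c D h -> localized (c + x) D (wshift x w1 h).
Proof.
move=> hD z zD; rewrite wshiftE hD ?mulr0//; apply: contra zD => zD.
have x0 : box x 0 x by apply/forallP => i; rewrite subrr.
by have := box_add zD x0; rewrite subrK addn0.
Qed.

Lemma localized_l1 c D h s : localized c D h -> uniq s ->
  \sum_(z <- s) cabs (h z) <= ((2 * D + 1) ^ n)%:R * ell2_rnorm h.
Proof.
move=> hD us; rewrite (bigID (box c D))/= [X in _ + X]big1 ?addr0; last first.
  by move=> z zD; rewrite hD ?cabs0.
rewrite -big_filter.
apply: (@le_trans _ _ (\sum_(z <- s | box c D z) ell2_rnorm h)).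
  by rewrite big_filter; apply: ler_sum => z _; exact: cabs_le_ell2.
rewrite -big_filter big_const_seq count_predT iter_addr_0 -[leLHS]mulr_natl.
rewrite ler_wpM2r ?ell2_rnorm_ge0// ler_nat.
by rewrite (@size_box c)// ?filter_uniq// filter_all.
Qed.

Definition propagates d p := forall c D h,
  localized c D h -> localized c (D + d) (p h).

Lemma propagates_wshift d x w (w1 : forall z, cabs (w z) = 1) :
  box 0 d x -> propagates d (wshift x w1).
Proof.
move=> xd c D h hD z zD; rewrite wshiftE hD ?mulr0//.
by apply: contra zD => zD; have := box_add zD xd; rewrite subrK addr0.
Qed.

Lemma propagatesZ d (a : R[i]) p : propagates d p -> propagates d (a *: p).
Proof. by move=> pd c D h hD z zD; rewrite bopZE ell2ZE (pd c D) ?mulr0. Qed.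

Lemma propagates_sum d (I : eqType) (s : seq I) (p : I -> bop ell2) :
  (forall i, i \in s -> propagates d (p i)) ->
  propagates d (\sum_(i <- s) p i).
Proof.
move=> pd c D h hD; rewrite bop_sumE; apply: localized_sum => i si.
exact: pd.
Qed.

Lemma propagates_1sub d p : propagates d p -> propagates d (1 - p).
Proof.
move=> pd c D h hD z zD; rewrite bopDE bopNE bop1E ell2DE ell2NE.
by rewrite (pd c D)// oppr0 addr0 (localized_le (leq_addr d D) hD).
Qed.

Lemma propagatesM d d' p p' : propagates d p -> propagates d' p' ->
  propagates (d' + d) (p * p').
Proof. by move=> pd pd' c D h hD; rewrite bopME addnA; apply/pd/pd'. Qed.

(** [M] is a norm of [A], from functions in l^2 with localized support to l^1.
    All centres [c] are allowed: this makes the bound invariant under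
    precomposition with weighted shifts, which move a box without changing its
    radius. *)
Definition l1_bound D A (M : R) := forall c h, localized c D h ->
  forall s, uniq s -> \sum_(z <- s) cabs (A h z) <= M * ell2_rnorm h.

Lemma l1_bound1 D : l1_bound D 1 ((2 * D + 1) ^ n)%:R.
Proof. by move=> c h hD s us; exact: localized_l1 hD us. Qed.

Lemma l1_bound_le D D' A M : (D <= D')%N -> l1_bound D' A M -> l1_bound D A M.
Proof. by move=> DD' AM c h hD; apply: (AM c); exact: localized_le hD. Qed.

Lemma l1_bound_weaken D A M M' : M <= M' -> l1_bound D A M -> l1_bound D A M'.
Proof.
move=> MM' AM c h hD s us; apply: le_trans (AM c h hD s us) _.
by rewrite ler_wpM2r ?ell2_rnorm_ge0.
Qed.

Lemma l1_boundD D A B M N : l1_bound D A M -> l1_bound D B N ->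
  l1_bound D (A + B) (M + N).
Proof.
move=> AM BN c h hD s us; rewrite mulrDl.
apply: le_trans (lerD (AM c h hD s us) (BN c h hD s us)).
rewrite -big_split; apply: ler_sum => z _; rewrite bopDE ell2DE.
exact: cabsD.
Qed.

Lemma l1_boundZ D A M (a : R[i]) : l1_bound D A M ->
  l1_bound D (a *: A) (cabs a * M).
Proof.
move=> AM c h hD s us; rewrite -mulrA.
apply: le_trans (ler_wpM2l (cabs_ge0 a) (AM c h hD s us)).
by rewrite mulr_sumr; apply: ler_sum => z _; rewrite bopZE ell2ZE cabsM.
Qed.

Lemma l1_bound_wshift D A M x w (w1 : forall z, cabs (w z) = 1) :
  l1_bound D A M -> l1_bound D (A * wshift x w1) M.
Proof.
move=> AM c h hD s us; rewrite -(wshift_rnorm x w1 h).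
by apply: (AM (c + x)) => //; exact: localized_wshift.
Qed.

Lemma l1_bound_sum_wshift D A M (s : seq Zn) (a : Zn -> R[i])
    (x : Zn -> Zn) (w : Zn -> Zn -> R[i]) (w1 : forall y z, cabs (w y z) = 1) :
  l1_bound D A M ->
  l1_bound D (A * \sum_(y <- s) a y *: wshift (x y) (w1 y))
    ((\sum_(y <- s) cabs (a y)) * M).
Proof.
move=> AM; rewrite mulr_sumr mulr_suml.
elim: s => [|y s IH]; first by rewrite !big_nil => c h _ s _;
  rewrite mul0r big1// => z _; rewrite cabs0.
rewrite !big_cons; apply: l1_boundD => //; rewrite scalebopAr.
by apply: l1_boundZ; exact: l1_bound_wshift.
Qed.

Lemma l1_bound_propagates D d A p (M r : R) : propagates d p -> 0 <= M ->
  (forall h, ell2_rnorm (p h) <= r * ell2_rnorm h) ->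
  l1_bound (D + d) A M -> l1_bound D (A * p) (r * M).
Proof.
move=> pd M0 pr AM c h hD s us; rewrite bopME.
apply: le_trans (AM c (p h) (pd _ _ _ hD) s us) _.
by rewrite [r * M]mulrC -mulrA ler_wpM2l.
Qed.

(** [lambda f] spreads supports without limit, yet it costs no increase of the
    radius [D]: it is the combination, with coefficients [f x], of the weighted
    shifts [lshift x], and each of them preserves the bound.  For the infinite
    sum, [f] is cut off outside a finite set; the remainder is small as an
    operator on l^2, hence negligible on the finite list [s] of tested points. *)
Lemma l1_bound_lambda (theta : 'M[circle R]_n) D A M f : 0 <= M ->
  l1_bound D A M -> l1_bound D (A * lambda theta f) (l1norm f * M).
Proof.
move=> M0 AM c h hD s us; apply/ler_addgt0Pr => e e0.
set K := (size s)%:R * (opnorm A * (2 * ell2_rnorm h)).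
have K0 : 0 <= K by rewrite !mulr_ge0 ?opnorm_ge0 ?ell2_rnorm_ge0.
have eK : 0 < e / (K + 1) by rewrite divr_gt0// ltr_wpDl.
have [y uy ye] := l1norm_tail f eK.
rewrite (lambda_cutoff theta f uy) mulrDr bopDE.
set F := \sum_(x <- y) _.
apply: (@le_trans _ _ (\sum_(z <- s) cabs ((A * F) h z) +
    \sum_(z <- s) cabs ((A * lambda theta (cutoff f y)) h z))).
  by rewrite -big_split; apply: ler_sum => z _; rewrite ell2DE cabsD.
apply: lerD.
  apply: le_trans (@l1_bound_sum_wshift D A M y f id _
    (fun x z => cabs_cocycle theta x (z - x)) AM c h hD s us) _.
  rewrite ler_wpM2r ?ell2_rnorm_ge0// ler_wpM2r//; exact: l1norm_sum.
apply: (@le_trans _ _ (\sum_(z <- s)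
    (opnorm A * (2 * l1norm (cutoff f y) * ell2_rnorm h)))).
  apply: ler_sum => z _; apply: le_trans (cabs_le_ell2 _ _) _.
  rewrite bopME; apply: le_trans (bop_rnorm_le _ _) _.
  by rewrite ler_wpM2l ?opnorm_ge0//; exact: lambda_rnorm_le.
rewrite big_const_seq count_predT iter_addr_0 -[leLHS]mulr_natl.
have -> : (size s)%:R * (opnorm A * (2 * l1norm (cutoff f y) * ell2_rnorm h))
  = K * l1norm (cutoff f y) by rewrite /K; ring.
apply: le_trans (ler_wpM2l K0 ye) _.
by rewrite mulrCA ler_piMr ?(ltW e0)// ler_pdivrMr ?mul1r ?lerDl// ltr_wpDl.
Qed.

(** In each factor of the power, [p] scales the l^2 norm by at most [r] at the price of
    a radius larger by [d], while [e] multiplies the l^1 bound by [eps] at the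
    same radius.  So the radius is at most [D + k * d] throughout, and the final
    passage from l^2 to l^1 costs no more than the number of points of a box,
    which is polynomial in [k]. *)
Lemma l1_bound_exp D d p e (r eps : R) : 0 <= r -> 0 <= eps ->
  propagates d p -> (forall h, ell2_rnorm (p h) <= r * ell2_rnorm h) ->
  (forall D' A M, 0 <= M -> l1_bound D' A M ->
    l1_bound D' (A * e) (eps * M)) ->
  forall k, l1_bound D ((p + e) ^+ k)
    ((r + eps) ^+ k * ((2 * (D + k * d) + 1) ^ n)%:R).
Proof.
move=> r0 eps0 pd pr eb k; elim: k D => [|k IH] D.
  by rewrite expr0 mul0n addn0 mul1r; exact: l1_bound1.
(* The new factor is the innermost one, the one applied first: the induction
   hypothesis is used at the enlarged radius [D + d]. *)
rewrite exprSr mulrDr exprS -mulrA mulrDl.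
have M0 : 0 <= (r + eps) ^+ k * ((2 * (D + k.+1 * d) + 1) ^ n)%:R :> R.
  by rewrite mulr_ge0// exprn_ge0// addr_ge0.
have E : l1_bound (D + d) ((p + e) ^+ k)
    ((r + eps) ^+ k * ((2 * (D + k.+1 * d) + 1) ^ n)%:R).
  have -> : (D + k.+1 * d = D + d + k * d)%N by lia.
  exact: IH.
apply: l1_boundD; first exact: l1_bound_propagates pd _ pr E.
by apply: eb => //; apply: l1_bound_le E; exact: leq_addr.
Qed.

End Localization.

(** * Geometric decay and Neumann series *)

Section GeometricDecay.
Variable R : realType.
Implicit Types (r x : R).

Lemma bernoulli_ineq x k : -1 <= x -> 1 + k%:R * x <= (1 + x) ^+ k.
Proof.
move=> x1; elim: k => [|k IH]; first by rewrite mul0r addr0 expr0.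
rewrite exprS; apply: le_trans (ler_wpM2l _ IH); last by lra.
have k0 : 0 <= k%:R * x ^+ 2 :> R by rewrite mulr_ge0 ?sqr_ge0.
by rewrite -natr1; nra.
Qed.

Lemma poly_times_geometric r (a b n : nat) : 0 <= r -> r < 1 ->
  exists C q, [/\ 0 <= C, 0 <= q, q < 1 &
    forall k, r ^+ k * ((a + k * b) ^ n)%:R <= C * q ^+ k].
Proof.
(* With nu = 1 - y, Bernoulli's inequality gives both r < nu ^ n, so that
   q = r / nu ^ n works, and a + k b <= C nu ^- k. *)
move=> r0 r1.
have [y y0 ny] : exists2 y : R, 0 < y & n%:R * y + 2 * y = 1 - r.
  have n2 : 0 < n.+2%:R :> R by rewrite ltr0n.
  exists ((1 - r) / n.+2%:R); first by rewrite divr_gt0// subr_gt0.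
  by rewrite -mulrDl -natrD addn2 mulrC divfK// gt_eqF.
have ny0 : 0 <= n%:R * y by rewrite mulr_ge0// ltW.
pose nu := 1 - y; have nu0 : 0 < nu by rewrite /nu; lra.
have nun : r < nu ^+ n.
  apply: lt_le_trans (bernoulli_ineq n _); last by lra.
  by rewrite mulrN; lra.
have nun0 : 0 < nu ^+ n by rewrite exprn_gt0.
pose C := a%:R + b%:R / y.
have C0 : 0 <= C by rewrite addr_ge0// divr_ge0// ltW.
exists (C ^+ n), (r / nu ^+ n); split.
- by rewrite exprn_ge0.
- by rewrite divr_ge0// ltW.
- by rewrite ltr_pdivrMr// mul1r.
move=> k; rewrite expr_div_n mulrCA ler_wpM2l ?exprn_ge0//.
rewrite -exprM [(n * k)%N]mulnC exprM -expr_div_n natrX lerXn2r ?nnegrE//.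
  by rewrite divr_ge0// exprn_ge0// ltW.
rewrite ler_pdivlMr ?exprn_gt0//.
have step : (1 + k%:R * y) * nu ^+ k <= 1.
  apply: (@le_trans _ _ ((1 + y) ^+ k * nu ^+ k)).
    by rewrite ler_wpM2r ?exprn_ge0 ?(ltW nu0)// bernoulli_ineq//; lra.
  rewrite -exprMn exprn_ile1//; rewrite /nu; nra.
apply: le_trans (_ : C * ((1 + k%:R * y) * nu ^+ k) <= _); last first.
  by rewrite -[leRHS]mulr1 ler_wpM2l.
rewrite mulrA ler_wpM2r ?exprn_ge0 ?(ltW nu0)//.
rewrite natrD natrM.
have -> : C * (1 + k%:R * y) =
    a%:R + k%:R * b%:R + (a%:R * (k%:R * y) + b%:R / y).
  by rewrite /C; field; rewrite gt_eqF.
by rewrite lerDl addr_ge0// ?divr_ge0 ?mulr_ge0// ltW.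
Qed.

Lemma geometric_sum_le (q C : R) N : 0 <= C -> 0 <= q -> q < 1 ->
  \sum_(k < N) C * q ^+ k <= C / (1 - q).
Proof.
move=> C0 q0 q1; rewrite -mulr_sumr ler_wpM2l// -[leRHS]mul1r.
rewrite ler_pdivlMr ?subr_gt0// mulrC.
have := subrX1 q N; have := exprn_ge0 N q0; lra.
Qed.

End GeometricDecay.

Section Neumann.
Variables (R : realType) (T : choiceType).
Local Notation ell2 := (ell2 R T).

Lemma bop_exp_rnorm_le (S : bop ell2) (r : R) k (g : ell2) :
  0 <= r -> (forall h, ell2_rnorm (S h) <= r * ell2_rnorm h) ->
  ell2_rnorm ((S ^+ k) g) <= r ^+ k * ell2_rnorm g.
Proof.
move=> r0 Sr; elim: k => [|k IH]; first by rewrite !expr0 mul1r bop1E.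
by rewrite !exprS bopME -mulrA (le_trans (Sr _))// ler_wpM2l.
Qed.

(** Iterating the equation, [g] is the partial sum of the series of the
    [(S ^+ k) h] up to [(S ^+ N) g].  That remainder is small in the l^2 norm only,
    which is enough to bound |g| on a finite list of points. *)
Lemma neumann_l1 (S : bop ell2) (g h : ell2) (r C q : R) :
  g = S g + h -> 0 <= r -> r < 1 ->
  (forall x, ell2_rnorm (S x) <= r * ell2_rnorm x) ->
  0 <= C -> 0 <= q -> q < 1 ->
  (forall k s, uniq s -> \sum_(z <- s) cabs ((S ^+ k) h z) <= C * q ^+ k) ->
  (nnsum (fun z => cabs (g z)) < +oo)%E.
Proof.
move=> gE r0 r1 Sr C0 q0 q1 hk.
have gN N : g = (S ^+ N) g + \sum_(k < N) (S ^+ k) h.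
  elim: N => [|N IH]; first by rewrite expr0 big_ord0 addr0.
  rewrite big_ord_recr/= [X in _ = _ + X]addrC addrA.
  by rewrite exprSr bopME -bopD -gE.
suff : (nnsum (fun z => cabs (g z)) <= (C / (1 - q))%:E)%E.
  by move=> /le_lt_trans; apply; rewrite ltry.
apply/nnsum_leP => [z|s us]; first exact: cabs_ge0.
apply/ler_addgt0Pr => e e0.
set K := (size s)%:R * ell2_rnorm g.
have K0 : 0 <= K by rewrite mulr_ge0 ?ell2_rnorm_ge0.
have eK : 0 < e / (K + 1) by rewrite divr_gt0// ltr_wpDl.
have [N rN] : exists N, r ^+ N <= e / (K + 1).
  have nr1 : `|r| < 1 by rewrite ger0_norm.
  have /cvgrPdist_lt/(_ _ eK)[N _ /(_ N (leqnn N))] := cvg_expr nr1.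
  rewrite /= sub0r normrN ger0_norm ?exprn_ge0// => /ltW rN.
  by exists N.
rewrite addrC.
apply: (@le_trans _ _ (\sum_(z <- s) cabs ((S ^+ N) g z) +
    \sum_(z <- s) \sum_(k < N) cabs ((S ^+ k) h z))).
  rewrite -big_split; apply: ler_sum => z _ /=.
  rewrite {1}(gN N) ell2DE ell2_sumE (le_trans (cabsD _ _))// lerD2l//.
  elim/big_ind2: _ => [|x a y b xa yb|//]; first by rewrite cabs0.
  by rewrite (le_trans (cabsD _ _))// lerD.
apply: lerD.
  apply: (@le_trans _ _ (\sum_(z <- s) r ^+ N * ell2_rnorm g)).
    apply: ler_sum => z _; apply: le_trans (cabs_le_ell2 _ _) _.
    exact: bop_exp_rnorm_le.
  rewrite big_const_seq count_predT iter_addr_0 -[leLHS]mulr_natl.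
  rewrite mulrCA -/K mulrC; apply: le_trans (ler_wpM2l K0 rN) _.
  by rewrite mulrCA ler_piMr ?(ltW e0)// ler_pdivrMr ?mul1r ?lerDl// ltr_wpDl.
rewrite exchange_big/=; apply: le_trans (geometric_sum_le N C0 q0 q1).
by apply: ler_sum => k _; exact: hk.
Qed.

End Neumann.
(** * Operators determined by their values on point masses *)

Section StandardBasis.
Variables (R : realType) (T : choiceType).
Local Notation ell2 := (ell2 R T).

Lemma delta_ell2 (y : T) :
  (fun x => (x == y)%:R : R[i]) \in @ell2_pred R T.
Proof.
rewrite inE /= /sqsum (@nnsum_eq_single _ _ _ y) ?ltry//.
  by move=> x; rewrite sqr_ge0.
by move=> x /negbTE ->; rewrite cabs0 expr0n.
Qed.

Definition delta y : ell2 := Ell2 (delta_ell2 y).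

Lemma deltaE y x : delta y x = (x == y)%:R.
Proof. by []. Qed.

(** The point masses span a dense subspace, and bounded operators are continuous. *)
Lemma bop_ext_delta (S1 S2 : bop ell2) :
  (forall y, S1 (delta y) = S2 (delta y)) -> S1 = S2.
Proof.
move=> S12; apply/eqP; rewrite -subr_eq0; apply/eqP.
set S := S1 - S2.
have S0 y : S (delta y) = 0 by rewrite bopDE bopNE S12 subrr.
apply: bop_ext => h x; suff -> : S h = 0 by [].
apply: ell2_rnorm_eq0; apply/eqP; rewrite eq_le ell2_rnorm_ge0 andbT.
apply/ler_addgt0Pr => e e0; rewrite add0r.
have K0 : 0 < opnorm S + 1 by rewrite ltr_wpDl// opnorm_ge0.
have eK : 0 < e / (opnorm S + 1) by rewrite divr_gt0.
have [s us se] := nnsum_tail (fun x => sqr_ge0 (cabs (h x))) (ell2P h)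
  (exprn_gt0 2 eK).
pose t : ell2 := h - \sum_(y <- s) h y *: delta y.
have tE z : t z = if z \in s then 0 else h z.
  rewrite ell2DE ell2NE ell2_sumE.
  have [zs|zs] := boolP (z \in s).
    rewrite (bigD1_seq z)// ell2ZE deltaE eqxx mulr1 big1 => [|y /negbTE yz].
      by rewrite /= addr0 subrr.
    by rewrite ell2ZE deltaE eq_sym yz mulr0.
  rewrite big_seq big1 ?subr0// => y ys; rewrite ell2ZE deltaE.
  by case: eqP ys zs => [->->//|_ _ _]; rewrite mulr0.
have -> : S h = S t.
  rewrite bopB bop_sum big1 ?subr0// => y _.
  by rewrite bopZ S0 scaler0.
have te : ell2_rnorm t <= e / (opnorm S + 1).
  apply: ell2_rnorm_le; first exact: ltW.
  apply: le_trans se; apply: le_nnsum => z; rewrite tE.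
  by case: ifP => // _; rewrite cabs0 expr0n.
apply: le_trans (bop_rnorm_le _ _) _.
apply: le_trans (ler_wpM2l (opnorm_ge0 S) te) _.
by rewrite mulrCA ler_piMr ?(ltW e0)// ler_pdivrMr ?mul1r ?lerDl.
Qed.

End StandardBasis.

Section Covariance.
Variables (R : realType) (n : nat) (theta : 'M[circle R]_n).
Local Notation Zn := 'rV[int]_n.
Local Notation ell2 := (ell2 R Zn).
Local Notation lambda := (lambda theta).

Lemma rshift_delta y : rshift theta y (delta R 0) = delta R y.
Proof.
apply/val_inj/funext => z.
rewrite -[LHS]/(cocycle theta (z - y) y * (z - y == 0)%:R).
rewrite -[RHS]/((z == y)%:R) subr_eq0.
by case: eqP => [->|_]; rewrite ?mulr0// subrr cocycle0l mulr1.
Qed.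

Lemma lambda_delta0 (f : ell1 R n) z : lambda f (delta R 0) z = f z.
Proof.
rewrite lambdaE /tconv (@csum_eq_single _ _ _ z) => [|y yz].
  by rewrite subrr cocycle0r mulr1 deltaE eqxx mulr1.
by rewrite deltaE subr_eq0 eq_sym (negbTE yz) mulr0 mul0r.
Qed.

(** The right translates of [delta R 0] are the point masses, up to the trivial
    phase [cocycle 0 y]; so an operator that commutes with right translations is
    determined by its value at [delta R 0]. *)
Lemma lambda_of_column (b : bop ell2) (g : ell1 R n) :
  (forall y, b * rshift theta y = rshift theta y * b) ->
  (forall z, b (delta R 0) z = g z) -> b = lambda g.
Proof.
move=> bV bg; apply: bop_ext_delta => y.
rewrite -rshift_delta -!bopME bV lambda_rshift !bopME; congr (rshift _ _ _).
by apply/val_inj/funext => z; rewrite [LHS]bg [RHS]lambda_delta0.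
Qed.

End Covariance.

(** * Inverses of elements of the twisted convolution algebra *)

Section InverseClosed.
Variables (R : realType) (n : nat) (theta : 'M[circle R]_n).
Local Notation Zn := 'rV[int]_n.
Local Notation ell2 := (ell2 R Zn).
Local Notation lambda := (lambda theta).
Local Notation lshift := (lshift theta).

(** The weight produced by [wshift_adjoint], with [z + x - x] left as it stands so
    that it matches. *)
Lemma adj_weight1 (x : Zn) z : cabs ((cocycle theta x (z + x - x))^*)%C = 1.
Proof. by rewrite cabs_conj cabs_cocycle. Qed.

Definition lshift_adj x : bop ell2 := wshift (- x) (adj_weight1 x).

Definition trunc (f : ell1 R n) s : bop ell2 := \sum_(x <- s) f x *: lshift x.

Definition trunc_adj (f : ell1 R n) s : bop ell2 :=
  \sum_(x <- s) ((f x)^*)%C *: lshift_adj x.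

Lemma trunc_adjP f s : re_adjoint (trunc f s) (trunc_adj f s).
Proof.
by apply: re_adjoint_sum => x; apply: re_adjointZ; exact: wshift_adjoint.
Qed.

Lemma trunc_adj_rnorm_le f s h : uniq s ->
  ell2_rnorm (trunc_adj f s h) <= l1norm f * ell2_rnorm h.
Proof.
move=> us; rewrite bop_sumE; apply: le_trans (ell2_rnorm_sum _ _) _.
apply: le_trans (ler_wpM2r (ell2_rnorm_ge0 h) (l1norm_sum f us)).
rewrite mulr_suml; apply: ler_sum => x _.
by rewrite bopZE ell2_rnormZ wshift_rnorm cabs_conj.
Qed.

Lemma l1_bound_trunc_adj D A (M : R) f s : uniq s -> 0 <= M ->
  l1_bound D A M -> l1_bound D (A * trunc_adj f s) (l1norm f * M).
Proof.
move=> us M0 AM.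
apply: l1_bound_weaken (@l1_bound_sum_wshift _ _ D A M s
  (fun x => ((f x)^*)%C) (fun x => - x) _ (fun x => adj_weight1 x) AM).
rewrite ler_wpM2r//; apply: le_trans (l1norm_sum f us).
by apply: ler_sum => x _; rewrite cabs_conj.
Qed.

Lemma propagates_trunc d f s : (forall x, x \in s -> box 0 d x) ->
  propagates d (trunc f s).
Proof.
move=> sd; apply: propagates_sum => x xs; apply: propagatesZ.
exact: propagates_wshift (sd x xs).
Qed.

Lemma propagates_trunc_adj d f s : (forall x, x \in s -> box 0 d x) ->
  propagates d (trunc_adj f s).
Proof.
move=> sd; apply: propagates_sum => x xs; apply: propagatesZ.
exact: propagates_wshift (box_opp (sd x xs)).
Qed.

(** Let P and E be the actions of [f] on a finite set [s] and off it, and Q the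
    adjoint of P.  With S = 1 - t Q (lambda f), the column b delta_0 solves
    g = S g + t Q delta_0.  Here S = p + e, where p = 1 - t Q P is a finite
    combination of weighted shifts and a strict contraction, and e = - t Q E is
    small.  The scales are chosen in this order: t and the lower bound beta come
    from [f] and [b] alone, hence so does the gap tb / 2 = t beta^2 / 2 of p
    below 1; only then is [s] taken large enough for E to be small compared with
    that gap. *)
Lemma inverse_column_summable f (b : bop ell2) :
  lambda f * b = 1 -> b * lambda f = 1 ->
  (nnsum (fun z => cabs (b (delta R (0%R : Zn)) z)) < +oo)%E.
Proof.
move=> ab ba.
set L := l1norm f; have L0 : 0 <= L := l1norm_ge0 f.
pose k := L + 1; have k1 : 1 <= k by rewrite /k; lra.
pose B := opnorm b + 1.
have B1 : 1 <= B by rewrite /B; have := opnorm_ge0 b; lra.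
have [beta [beta0 beta1 fbeta]] : exists beta : R, [/\ 0 < beta, beta <= 1 &
    forall h, 2 * beta * ell2_rnorm h <= ell2_rnorm (lambda f h)].
  exists (B^-1 / 2); split.
  - by rewrite divr_gt0// invr_gt0; lra.
  - by rewrite ler_pdivrMr// mul1r (@le_trans _ _ 1)// ?invf_le1; lra.
  move=> h; have -> : 2 * (B^-1 / 2) = B^-1.
    by field; rewrite gt_eqF//; lra.
  rewrite ler_pdivrMl; last by lra.
  have hE : b (lambda f h) = h by rewrite -bopME ba.
  rewrite -{1}hE.
  apply: le_trans (bop_rnorm_le _ _) _.
  by rewrite ler_wpM2r ?ell2_rnorm_ge0// /B lerDl.
(* k bounds the norm of Q, whatever [s] will be. *)
pose t := k ^- 2.
have tk : t * k ^+ 2 = 1 by rewrite mulVf// sqrf_eq0 gt_eqF//; lra.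
have t0 : 0 < t by rewrite invr_gt0 exprn_gt0//; lra.
pose tb := t * beta ^+ 2.
have tb0 : 0 < tb by rewrite mulr_gt0// exprn_gt0.
have tb1 : tb <= 1.
  by rewrite -tk ler_wpM2l ?(ltW t0)// lerXn2r ?nnegrE//; lra.
have [rho0 eps0] : 0 <= 1 - tb / 2 /\ 0 <= tb / 8 by split; lra.
have [r0 r1] : 0 <= 1 - 3 / 8 * tb /\ 1 - 3 / 8 * tb < 1 by split; lra.
have [r'0 r'1] : 0 <= 1 - tb / 4 /\ 1 - tb / 4 < 1 by split; lra.
(* The operator norm of E is only controlled by twice the l^1 norm of its
   symbol.  The choice of eta makes e small in both senses: t k eta = tb / 8 in
   l^1 bounds and twice that in operator norm, both less than tb / 2. *)
have [eta [eta0 etab etaE]] : exists eta : R,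
    [/\ 0 < eta, 2 * eta <= beta & t * k * eta = tb / 8].
  exists (beta ^+ 2 / (8 * k)); split.
  - by rewrite divr_gt0 ?exprn_gt0//; lra.
  - by rewrite mulrA ler_pdivrMr; [nra|lra].
  - by rewrite /tb; field; rewrite gt_eqF//; lra.
have [s us seta] := l1norm_tail f eta0.
have fE := lambda_cutoff theta f us; rewrite -/(trunc f s) in fE.
set E := lambda (cutoff f s) in fE.
have El1 : 0 <= l1norm (cutoff f s) := l1norm_ge0 _.
have Enorm h : ell2_rnorm (E h) <= 2 * eta * ell2_rnorm h.
  apply: le_trans (lambda_rnorm_le _ _ _) _.
  by rewrite ler_wpM2r ?ell2_rnorm_ge0//; lra.
set P := trunc f s in fE; pose Q := trunc_adj f s.
have Qk h : ell2_rnorm (Q h) <= k * ell2_rnorm h.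
  apply: le_trans (trunc_adj_rnorm_le _ _ us) _.
  by rewrite ler_wpM2r ?ell2_rnorm_ge0// /k lerDl.
(* P = lambda f - E inherits half of the lower bound 2 beta. *)
have Pbeta h : beta * ell2_rnorm h <= ell2_rnorm (P h).
  have := fbeta h; rewrite fE bopDE => fh.
  have := le_trans fh (ell2_rnormD _ _); have := Enorm h.
  have := ell2_rnorm_ge0 h; nra.
have [d sd] := box_seq s.
pose p : bop ell2 := 1 - (t%:C)%C *: (Q * P).
have pd : propagates (d + d) p.
  apply: propagates_1sub; apply: propagatesZ; apply: propagatesM.
    exact: propagates_trunc_adj.
  exact: propagates_trunc.
have pr h : ell2_rnorm (p h) <= (1 - tb / 2) * ell2_rnorm h.
  by apply: (gram_contraction (@trunc_adjP f s)) => //; lra.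
pose e : bop ell2 := ((- t)%:C)%C *: (Q * E).
have cabst : cabs ((- t)%:C)%C = t.
  apply/(@complexI R); rewrite -cabsE normc_def/= expr0n addr0 sqrrN sqrtr_sqr.
  by rewrite ger0_norm// ltW.
have el1 D A M : 0 <= M -> l1_bound D A M -> l1_bound D (A * e) (tb / 8 * M).
  move=> M0 AM; rewrite scalebopAr mulrA.
  have AQM := l1_bound_trunc_adj f us M0 AM.
  have LM0 : 0 <= l1norm f * M by rewrite mulr_ge0.
  apply: l1_bound_weaken (l1_boundZ _
    (l1_bound_lambda theta (cutoff f s) LM0 AQM)).
  rewrite cabst -etaE -!mulrA ler_wpM2l ?(ltW t0)// [leLHS]mulrCA.
  apply: ler_pM => //; first by rewrite mulr_ge0.
    by rewrite /k lerDl.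
  by rewrite ler_wpM2r.
have enorm h : ell2_rnorm (e h) <= tb / 4 * ell2_rnorm h.
  rewrite bopZE ell2_rnormZ cabst bopME.
  apply: (@le_trans _ _ (t * (k * (2 * eta * ell2_rnorm h)))).
    rewrite ler_wpM2l ?(ltW t0)//; apply: le_trans (Qk _) _.
    by rewrite ler_wpM2l ?Enorm//; lra.
  have -> : t * (k * (2 * eta * ell2_rnorm h)) =
    2 * (t * k * eta) * ell2_rnorm h by ring.
  by rewrite etaE le_eqVlt; apply/orP; left; apply/eqP; field.
pose S := p + e.
have SE : S = 1 - (t%:C)%C *: (Q * lambda f).
  rewrite /S /p /e fE mulrDr scalerDr opprD addrA; congr (_ + _).
  by rewrite rmorphN scaleNr.
pose h := (t%:C)%C *: Q (delta R (0%R : Zn)).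
have bS : b (delta R (0%R : Zn)) = S (b (delta R (0 : Zn))) + h.
  rewrite SE bopDE bopNE bopZE bopME.
  rewrite -[lambda f (b _)]bopME ab bop1E.
  by rewrite subrK.
have hd : localized 0 d h.
  have d0 : localized 0 0 (delta R (0%R : Zn)).
    move=> z zD; rewrite deltaE; case: eqP zD => // ->.
    by case/negP; apply/forallP => i; rewrite !mxE subrr.
  move=> z zd; rewrite ell2ZE (propagates_trunc_adj f sd d0) ?mulr0//.
have [C [q [C0 q0 q1 Cq]]] :=
  poly_times_geometric (2 * d + 1) (2 * (d + d)) n r0 r1.
have h0 := ell2_rnorm_ge0 h.
apply: (@neumann_l1 _ _ S _ h (1 - tb / 4) (C * ell2_rnorm h) q bS) => //.
- move=> x; rewrite bopDE; apply: le_trans (ell2_rnormD _ _) _.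
  have := pr x; have := enorm x; lra.
- by rewrite mulr_ge0.
move=> j u uu.
apply: le_trans (l1_bound_exp (D := d) rho0 eps0 pd pr el1 j hd uu) _.
rewrite [leRHS]mulrAC ler_wpM2r//.
have -> : (2 * (d + j * (d + d)) + 1 = 2 * d + 1 + j * (2 * (d + d)))%N.
  by rewrite mulnDr addnAC mulnCA.
have -> : 1 - tb / 2 + tb / 8 = 1 - 3 / 8 * tb by field.
exact: Cq.
Qed.

End InverseClosed.

Theorem theorem4 (R : realType) (n : nat) (hn : (0 < n)%N)
    (theta : 'M[circle R]_n)
    (theta_conj : forall j k : 'I_n,
      sval (theta k j) = ((sval (theta j k))^*)%C)
    (theta_diag : forall j : 'I_n, sval (theta j j) = 1) :
  inverse_closed (ell1_alg theta) (nc_torus theta).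
Proof.
move=> a b [f _ <-] _ ab ba.
have bg : (fun z => b (delta R (0 : 'rV[int]_n)) z) \in @ell1_pred R n.
  by rewrite inE; exact: inverse_column_summable ab ba.
exists (Ell1 bg) => //; symmetry.
(* With V = [rshift theta y], which commutes with a: b V = b V a b = b a V b = V b. *)
apply: lambda_of_column => [y|//].
rewrite -[LHS]mulr1 -ab mulrA -[b * _ * _]mulrA -lambda_rshift.
by rewrite mulrA ba mul1r.
Qed.
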